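(* Let $N$ be a finitely generated torsion-free nilpotent group, let $\phi\in\mathrm{Aut}(N)$, and let $\overline{\phi}$ be the automorphism of $H_1(N,\mathbb{Z})=N/[N,N]$ induced by $\phi$. Then $K_{\phi}=K_{\overline{\phi}}$.
   Context: For a finitely generated group $G$ with finite generating set $S$, $\ell=\ell_S$ denotes word length: $\ell(g)$ is the distance from $g$ to $1$ in the Cayley graph of $G$ with respect to $S$. For $\phi\in\mathrm{Aut}(G)$, the entropy of $\phi$ is $K_{\phi}=\max_{s\in S}\lim_{n\to\infty}\ell(\phi^n(s))^{1/n}$; the limit exists and $K_\phi$ does not depend on the choice of $S$. One always has $K_\phi\ge 1$. *)

(* Defs.v *)
From Stdlib Require Import Reals List ClassicalEpsilon.
Open Scope R_scope.

Record group := Group {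
  carrier :> Type;
  gmul : carrier -> carrier -> carrier;
  ginv : carrier -> carrier;
  gone : carrier;
  gmulA : forall x y z, gmul x (gmul y z) = gmul (gmul x y) z;
  gmul1x : forall x, gmul gone x = x;
  gmulx1 : forall x, gmul x gone = x;
  gmulVx : forall x, gmul (ginv x) x = gone;
  gmulxV : forall x, gmul x (ginv x) = gone
}.

Arguments gmul {g}.
Arguments ginv {g}.
Arguments gone {g}.

Section GroupDefs.
Variable G : group.

Fixpoint gpow (x : G) (n : nat) : G :=
  match n with O => gone | S k => gmul x (gpow x k) end.

Definition comm (a b : G) : G := gmul (ginv a) (gmul (ginv b) (gmul a b)).

Definition letter_val (l : bool * G) : G :=
  if fst l then ginv (snd l) else snd l.

Definition eval_word (w : list (bool * G)) : G :=
  fold_right (fun l acc => gmul (letter_val l) acc) gone w.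

Definition word_over (S : list G) (w : list (bool * G)) : Prop :=
  Forall (fun l => In (snd l) S) w.

Definition generates (S : list G) : Prop :=
  forall g : G, exists w, word_over S w /\ eval_word w = g.

(* Lower central series: gamma 0 = G, gamma (i+1) = [gamma i, G]
   (subgroup generated by commutators [x,g], x in gamma i, g in G). *)
Fixpoint gamma (i : nat) : G -> Prop :=
  match i with
  | O => fun _ => True
  | S k => fun x =>
      exists l : list (bool * (G * G)),
        Forall (fun p : bool * (G * G) => gamma k (fst (snd p))) l /\
        x = fold_right
              (fun (p : bool * (G * G)) (acc : G) =>
                 let c := comm (fst (snd p)) (snd (snd p)) in
                 gmul (if fst p then ginv c else c) acc) gone l
  end.

Definition nilpotent : Prop := exists c : nat, forall x, gamma c x -> x = gone.

Definition torsion_free : Prop :=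
  forall (x : G) (n : nat), gpow x (S n) = gone -> x = gone.

Definition in_commutator (x : G) : Prop := gamma 1 x.

Definition is_automorphism (phi : G -> G) : Prop :=
  (forall x y, phi (gmul x y) = gmul (phi x) (phi y)) /\
  (exists psi : G -> G, (forall x, psi (phi x) = x) /\ (forall x, phi (psi x) = x)).

Definition is_least (P : nat -> Prop) (n : nat) : Prop :=
  P n /\ forall m, P m -> (n <= m)%nat.

Definition wordlen (S : list G) (g : G) : nat :=
  epsilon (inhabits 0%nat)
    (is_least (fun n => exists w, word_over S w /\ length w = n /\ eval_word w = g)).

(* Word length of the coset g[G,G] in G/[G,G] w.r.t. the image of S:
   the least length of a word over S^{+-1} whose value lies in g[G,G]. *)
Definition ab_wordlen (S : list G) (g : G) : nat :=
  epsilon (inhabits 0%nat)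
    (is_least (fun n => exists w, word_over S w /\ length w = n /\
                                  in_commutator (gmul (ginv g) (eval_word w)))).

End GroupDefs.

Definition nroot (n : nat) (x : R) : R :=
  match Req_EM_T x 0 with
  | left _ => 0
  | right _ => Rpower x (/ INR n)
  end.

(* K is the entropy max_{s in S} lim_n len(phi^n s)^{1/n} computed with the
   length function len (the limits are required to exist). The max is taken
   together with 1 (K >= 1 always; only matters for the trivial group). *)
Definition entropy_is {G : group} (len : G -> nat) (phi : G -> G)
    (S : list G) (K : R) : Prop :=
  exists L : G -> R,
    (forall s, In s S ->
       Un_cv (fun n => nroot n (INR (len (Nat.iter n phi s)))) (L s)) /\
    K = fold_right Rmax 1 (map L S).

(* Main.v *)
(** Give the [i]-th term of the lower central series weight [i].  An element is short (length [O(n)])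
    exactly when it is a product, in any order, of [O(n^i)] commutators of weight [i], for every [i];
    more precisely an element of [gamma_i] of length [n] is, modulo [gamma_(i+1)], a product of
    [O(n^i)] basic commutators.

    Consequently, if some endomorphism [psi] preserving a subgroup [H] multiplies the number of
    letters of weight [i] (generators of [H ∩ gamma_i] modulo [gamma_(i+1)]) by at most [O(A^i)], up
    to letters of larger weight, then it multiplies lengths by about [A]: iterating [psi], the letters
    of larger weight are absorbed by a change of the constant.

    With [H] the subgroup generated by the orbit of [g] and [psi = phi^m], one can take
    [A = O(len (phi^m g))], with a constant independent of [m]; here one uses that subgroups of f.g.
    abelian groups are undistorted.  The resulting estimate [len (phi^(mk) g) <= E_m (C len (phi^m g))^k]
    yields the existence of the limit, as in Fekete's lemma, also for the abelianization.  With [H = N],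
    multilinearity of commutators allows to take for [A] the largest abelianized length of
    [phi^m s], [s] in [S]; this gives [K_phi <= K_(phi bar)]. *)
Require Import Defs.
From Stdlib Require Import Reals List Lia Lra ZArith Classical ClassicalEpsilon Wf_nat
  FunctionalExtensionality PropExtensionality ProofIrrelevance.
Open Scope R_scope.

(** * Groups and the lower central series *)

Declare Scope grp_scope.
Notation "x ** y" := (gmul x y) (at level 40, left associativity) : grp_scope.
Notation "x ^-1" := (ginv x) (at level 3, left associativity, format "x ^-1") : grp_scope.
Notation "[~ x , y ]" := (comm _ x y) (at level 0) : grp_scope.
Open Scope grp_scope.

(** In the code [gamma] and the levels are counted from 0, so a letter of level i weighs r^(i+1),
    with r = 1/n when lengths are compared with n. Weights multiply under commutators; hence moving
    a letter past a word of weight t multiplies its weight by at most exp(D t), with D independent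
    of r. This makes every collection estimate uniform in n. The letters are all left-normed
    commutators of the generators, and they may satisfy relations. The obstacle is that a product of
    letters of level k may lie in [gamma (k+1)] although its exponent sums do not vanish. The
    exponent vectors for which this happens form a subgroup of Z^d; it has a finite generating set
    in which lengths are linear in the norm, and each generator is rewritten once and for all in
    deeper letters. The same fact on subgroups of Z^d provides the letters of H at each level. In
    the estimates for phi^m, constants that depend on m only enter as factors in front of the k-th
    power, and disappear as k grows; constants inside the power do not depend on m, and their
    logarithm is divided by m. *)

Definition conjg {G : group} (x y : G) : G := y^-1 ** x ** y.

Section Group.
Variable G : group.
Implicit Types x y z g h : G.

Lemma mulKg x y : x^-1 ** (x ** y) = y.
Proof. now rewrite gmulA, gmulVx, gmul1x. Qed.

Lemma mulVKg x y : x ** (x^-1 ** y) = y.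
Proof. now rewrite gmulA, gmulxV, gmul1x. Qed.

Lemma mulg_inj x y z : x ** y = x ** z -> y = z.
Proof. intros H. now rewrite <- (mulKg x y), H, mulKg. Qed.

Lemma invg_uniq x y : x ** y = gone -> y = x^-1.
Proof. intros H. apply (mulg_inj x). now rewrite H, gmulxV. Qed.

Lemma invg1 : (gone : G)^-1 = gone.
Proof. symmetry. apply invg_uniq, gmul1x. Qed.

Lemma invgK x : x^-1^-1 = x.
Proof. symmetry. apply invg_uniq, gmulVx. Qed.

Lemma invMg x y : (x ** y)^-1 = y^-1 ** x^-1.
Proof.
  symmetry. apply invg_uniq.
  now rewrite <- gmulA, mulVKg, gmulxV.
Qed.

Lemma mulgA_r x y z : x ** y ** z = x ** (y ** z).
Proof. now rewrite gmulA. Qed.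

End Group.

(* These rules form the convergent rewriting system of free groups, so [grp] proves identities that
   hold in every group. *)
Hint Rewrite mulgA_r gmul1x gmulx1 gmulVx gmulxV mulKg mulVKg invg1 invgK invMg : grp.
Ltac grp := unfold conjg, comm; autorewrite with grp; try reflexivity.

Section Gamma.
Variable G : group.
Implicit Types x y z g h : G.

Lemma Hall_Witt x y z :
  conjg [~ [~ x, y^-1], z] y ** conjg [~ [~ y, z^-1], x] z
    ** conjg [~ [~ z, x^-1], y] x = gone.
Proof. grp. Qed.

Lemma gamma_one k : gamma G k gone.
Proof. destruct k as [|k]; [exact I|]. exists nil. now split. Qed.

Lemma gamma_mul k x y : gamma G k x -> gamma G k y -> gamma G k (x ** y).
Proof.
  destruct k as [|k]; [easy|]. intros [l [Hl ->]] [m [Hm ->]].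
  exists (l ++ m). split; [now apply Forall_app|].
  rewrite fold_right_app. clear Hl Hm.
  induction l as [|p l IH]; simpl in *; [apply gmul1x|].
  now rewrite <- IH, gmulA.
Qed.

Lemma gamma_comm k x g : gamma G k x -> gamma G (S k) [~ x, g].
Proof.
  intros Hx. exists ((false, (x, g)) :: nil). split.
  - now constructor.
  - simpl. now rewrite gmulx1.
Qed.

Lemma gamma_commV k x g : gamma G k x -> gamma G (S k) [~ x, g]^-1.
Proof.
  intros Hx. exists ((true, (x, g)) :: nil). split.
  - now constructor.
  - simpl. now rewrite gmulx1.
Qed.

Lemma gamma_ind k (P : G -> Prop) :
  P gone ->
  (forall x y, gamma G (S k) x -> P x -> gamma G (S k) y -> P y -> P (x ** y)) ->
  (forall x, gamma G (S k) x -> P x -> P x^-1) ->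
  (forall x g, gamma G k x -> P [~ x, g]) ->
  forall x, gamma G (S k) x -> P x.
Proof.
  intros H1 HM HV HC x [l [Hl ->]].
  assert (H : forall l, Forall (fun p : bool * (G * G) => gamma G k (fst (snd p))) l ->
    let x := fold_right (fun (p : bool * (G * G)) (acc : G) => let c := [~ fst (snd p), snd (snd p)] in
                   (if fst p then c^-1 else c) ** acc) gone l in
    gamma G (S k) x /\ P x); [|now apply H].
  clear l Hl. intros l Hl. induction Hl as [|[b [u v]] l Hp Hl [IH1 IH2]]; simpl.
  - split; [apply (gamma_one (S k))|assumption].
  - simpl in Hp. split.
    + apply (gamma_mul (S k)); [|assumption].
      destruct b; [now apply gamma_commV|now apply gamma_comm].
    + apply HM; try assumption.
      * destruct b; [now apply gamma_commV|now apply gamma_comm].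
      * destruct b; [apply HV; [now apply gamma_comm|]|]; now apply HC.
Qed.

Lemma gamma_inv k x : gamma G k x -> gamma G k x^-1.
Proof.
  destruct k as [|k]; [easy|]. intros [l [Hl ->]].
  induction Hl as [|[b [u v]] l Hp Hl IH]; simpl.
  - rewrite invg1. apply (gamma_one (S k)).
  - rewrite invMg. apply (gamma_mul (S k)); [exact IH|].
    destruct b; [rewrite invgK; now apply gamma_comm|now apply gamma_commV].
Qed.

Lemma gamma_conj k x g : gamma G k x -> gamma G k (conjg x g).
Proof.
  revert x g. induction k as [|k IH]; [easy|]. intros x g Hx. revert g.
  pattern x. revert x Hx. apply gamma_ind.
  - intros g. replace (conjg gone g) with (gone : G) by grp. apply gamma_one.
  - intros x y _ Hx _ Hy g. replace (conjg (x ** y) g) with (conjg x g ** conjg y g) by grp.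
    now apply gamma_mul.
  - intros x _ Hx g. replace (conjg x^-1 g) with (conjg x g)^-1 by grp. now apply gamma_inv.
  - intros x h Hx g.
    replace (conjg [~ x, h] g) with [~ conjg x g, conjg h g] by grp.
    now apply gamma_comm, IH.
Qed.

Lemma gamma_S k x : gamma G (S k) x -> gamma G k x.
Proof.
  revert x. apply gamma_ind.
  - apply gamma_one.
  - intros; now apply gamma_mul.
  - intros; now apply gamma_inv.
  - intros x g Hx. replace [~ x, g] with (x^-1 ** conjg x g) by grp.
    apply gamma_mul; [now apply gamma_inv|now apply gamma_conj].
Qed.

Lemma gamma_le j k x : (j <= k)%nat -> gamma G k x -> gamma G j x.
Proof. induction 1; [easy|]. intros H1. now apply IHle, gamma_S. Qed.

Lemma gamma_commC k x g : gamma G k x -> gamma G (S k) [~ g, x].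
Proof. intros H. replace [~ g, x] with [~ x, g]^-1 by grp. now apply gamma_commV. Qed.

Lemma gamma_conj_inv k x g : gamma G k (conjg x g) -> gamma G k x.
Proof.
  intros H. apply (gamma_conj k _ g^-1) in H.
  replace (conjg (conjg x g) g^-1) with x in H by grp. exact H.
Qed.

(** The three subgroups argument, by induction on j for all i at once. The shift by one comes from
    [gamma 0] being the whole group. *)
Lemma gamma_comm_gamma i j x y :
  gamma G i x -> gamma G j y -> gamma G (S (i + j)) [~ x, y].
Proof.
  revert i x y. induction j as [|j IH]; intros i x y Hx Hy.
  { rewrite Nat.add_0_r. now apply gamma_comm. }
  replace (i + S j)%nat with (S (i + j)) by lia.
  revert i x Hx. pattern y. revert y Hy. apply gamma_ind.
  - intros i x _. replace [~ x, gone] with (gone : G) by grp. apply gamma_one.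
  - intros y z _ Hy _ Hz i x Hx.
    replace [~ x, y ** z] with ([~ x, z] ** conjg [~ x, y] z) by grp.
    apply gamma_mul; [now apply Hz|now apply gamma_conj, Hy].
  - intros y _ Hy i x Hx.
    replace [~ x, y^-1] with (conjg [~ x, y]^-1 y^-1) by grp.
    now apply gamma_conj, gamma_inv, Hy.
  - intros y g Hy i x Hx.
    replace [~ x, [~ y, g]] with [~ [~ y, g], x]^-1 by grp.
    apply gamma_inv, (gamma_conj_inv _ _ g^-1).
    (* The middle factor is a conjugate of [[y, g], x]. The outer ones come from [[x, y^-1], g^-1]
       and [[g^-1, x^-1], y], which the induction hypothesis on j places deep enough. *)
    pose proof (Hall_Witt x y g^-1) as E. rewrite invgK in E.
    set (a := conjg [~ [~ x, y^-1], g^-1] y) in E.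
    set (b := conjg _ g^-1) in E |- *.
    set (c := conjg [~ [~ g^-1, x^-1], y] x) in E.
    assert (Eb : b = a^-1 ** c^-1).
    { transitivity (a^-1 ** (a ** b ** c) ** c^-1); [grp|]. rewrite E. grp. }
    rewrite Eb. apply gamma_mul; apply gamma_inv; apply gamma_conj.
    + apply gamma_comm. rewrite <- Nat.add_succ_r. replace (i + S j)%nat with (S (i + j)) by lia.
      now apply IH, gamma_inv.
    + replace (S (S (i + j))) with (S (S i + j)) by lia.
      apply IH; [|assumption]. now apply gamma_commC, gamma_inv.
Qed.

Definition is_hom (f : G -> G) : Prop := forall x y, f (x ** y) = f x ** f y.

Lemma hom_one f : is_hom f -> f gone = gone.
Proof. intros H. apply (mulg_inj _ (f gone)). now rewrite <- H, !gmulx1. Qed.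

Lemma hom_inv f x : is_hom f -> f x^-1 = (f x)^-1.
Proof. intros H. apply invg_uniq. now rewrite <- H, gmulxV, hom_one. Qed.

Lemma hom_comm f x y : is_hom f -> f [~ x, y] = [~ f x, f y].
Proof. intros H. unfold comm. now rewrite !H, !hom_inv. Qed.

Lemma hom_gamma f k x : is_hom f -> gamma G k x -> gamma G k (f x).
Proof.
  intros H. revert x. induction k as [|k IH]; [easy|]. apply gamma_ind.
  - rewrite hom_one by easy. apply (gamma_one (S k)).
  - intros x y _ Hx _ Hy. rewrite H. now apply (gamma_mul (S k)).
  - intros x _ Hx. rewrite hom_inv by easy. now apply (gamma_inv (S k)).
  - intros x g Hx. rewrite hom_comm by easy. now apply gamma_comm, IH.
Qed.

Lemma hom_iter f m : is_hom f -> is_hom (Nat.iter m f).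
Proof. intros H x y. induction m as [|m IH]; simpl; [easy|]. now rewrite IH, H. Qed.

End Gamma.

(** * Words in commutators *)

(** Stands for a maximum over finitely many indices: from [c] on the bound 0 must do, as it does for
    trivial letters. *)
Lemma uniform_bound (c : nat) (P : nat -> nat -> Prop) :
  (forall i n m, (n <= m)%nat -> P i n -> P i m) ->
  (forall i, exists n, P i n) ->
  (forall i, (c <= i)%nat -> P i 0%nat) ->
  exists n, forall i, P i n.
Proof.
  intros Hm He H0.
  assert (H : exists n, forall i, (i < c)%nat -> P i n).
  { clear H0. induction c as [|c [n Hn]]; [exists 0%nat; lia|].
    destruct (He c) as [m Hc]. exists (n + m)%nat. intros i Hi.
    destruct (Nat.eq_dec i c) as [->|Hne].
    - apply (Hm _ m); [lia|easy].
    - apply (Hm _ n); [lia|apply Hn; lia]. }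
  destruct H as [n Hn]. exists n. intros i.
  destruct (Nat.lt_ge_cases i c); [now apply Hn|].
  apply (Hm _ 0%nat); [lia|now apply H0].
Qed.

Lemma uniform_bound2 (c d : nat) (P : nat -> nat -> nat -> Prop) :
  (forall i t n m, (n <= m)%nat -> P i t n -> P i t m) ->
  (forall i t, exists n, P i t n) ->
  (forall i t, (c <= i \/ d <= t)%nat -> P i t 0%nat) ->
  exists n, forall i t, P i t n.
Proof.
  intros Hm He H0. apply (uniform_bound c (fun i n => forall t, P i t n)).
  - intros i n m Hnm H t. now apply (Hm _ _ n).
  - intros i. apply (uniform_bound d (P i)); [apply Hm|apply He|].
    intros t Ht. apply H0. now right.
  - intros i Hi t. apply H0. now left.
Qed.

Lemma list_bound {A : Type} (Q : A -> nat -> Prop) (B : list A) :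
  (forall a n m, (n <= m)%nat -> Q a n -> Q a m) ->
  (forall a, In a B -> exists n, Q a n) -> exists n, forall a, In a B -> Q a n.
Proof.
  intros Hm. induction B as [|b B IH]; intros H; [now exists 0%nat|].
  destruct IH as [n Hn]; [intros a Ha; apply H; now right|].
  destruct (H b) as [m Hb]; [now left|].
  exists (n + m)%nat. intros a [<-|Ha].
  - apply (Hm _ m); [lia|easy].
  - apply (Hm _ n); [lia|now apply Hn].
Qed.

(* A signed letter [(b, (i, t))] stands for the [t]-th generator of level [i], inverted if [b]. *)
Definition letter : Type := bool * (nat * nat).
Definition lev (l : letter) : nat := fst (snd l).
Definition linv (l : letter) : letter := (negb (fst l), snd l).
Definition winv (w : list letter) : list letter := map linv (rev w).
Definition level_ge (k : nat) (w : list letter) : Prop := Forall (fun l => (k <= lev l)%nat) w.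
Definition level_eq (k : nat) (w : list letter) : Prop := Forall (fun l => lev l = k) w.

Lemma level_ge_le j k w : (j <= k)%nat -> level_ge k w -> level_ge j w.
Proof. intros Hjk. apply Forall_impl. intros l. lia. Qed.

Lemma level_eq_ge k w : level_eq k w -> level_ge k w.
Proof. apply Forall_impl. intros l. lia. Qed.

Lemma level_ge_app k v w : level_ge k v -> level_ge k w -> level_ge k (v ++ w).
Proof. intros Hv Hw. now apply Forall_app. Qed.

Lemma winv_Forall (P : letter -> Prop) w :
  (forall l, P l -> P (linv l)) -> Forall P w -> Forall P (winv w).
Proof.
  intros HP Hw. apply Forall_map. apply Forall_rev. revert Hw. now apply Forall_impl.
Qed.

Lemma winv_length w : length (winv w) = length w.
Proof. unfold winv. now rewrite length_map, length_rev. Qed.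

Section Alphabet.
Variable G : group.
Variable U : nat -> nat -> G.

Definition lv (l : letter) : G :=
  if fst l then (U (fst (snd l)) (snd (snd l)))^-1 else U (fst (snd l)) (snd (snd l)).

Definition ev (w : list letter) : G := fold_right (fun l acc => lv l ** acc) gone w.

Lemma ev_cons l w : ev (l :: w) = lv l ** ev w.
Proof. reflexivity. Qed.

Lemma ev_app v w : ev (v ++ w) = ev v ** ev w.
Proof.
  induction v as [|l v IH]; simpl; [now rewrite gmul1x|]. now rewrite IH, gmulA.
Qed.

Lemma lv_linv l : lv (linv l) = (lv l)^-1.
Proof. destruct l as [[|] [i t]]; unfold lv; simpl; [now rewrite invgK|easy]. Qed.

Lemma ev_winv w : ev (winv w) = (ev w)^-1.
Proof.
  unfold winv. induction w as [|l w IH]; simpl; [now rewrite invg1|].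
  rewrite map_app, ev_app, IH, invMg. simpl. now rewrite lv_linv, gmulx1.
Qed.

Hypothesis U_gamma : forall i t, gamma G i (U i t).

Lemma lv_gamma l : gamma G (lev l) (lv l).
Proof. destruct l as [[|] [i t]]; [apply gamma_inv|]; apply U_gamma. Qed.

Lemma ev_gamma k w : level_ge k w -> gamma G k (ev w).
Proof.
  induction 1 as [|l w Hl Hw IH]; simpl; [apply gamma_one|].
  apply gamma_mul; [|easy]. apply (gamma_le _ _ (lev l)); [easy|apply lv_gamma].
Qed.

(** Length in the quotient of [gamma i] by [gamma (i+1)], in the generators of level i. The
    congruence already puts x in [gamma i]. *)
Definition level_len (i n : nat) (x : G) : Prop :=
  exists w, level_eq i w /\ (length w <= n)%nat /\ gamma G (S i) ((ev w)^-1 ** x).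

Lemma level_len_le i n m x : (n <= m)%nat -> level_len i n x -> level_len i m x.
Proof. intros Hnm (w & H1 & H2 & H3). exists w. repeat split; [easy|lia|easy]. Qed.

Lemma level_len_gamma i x : gamma G (S i) x -> level_len i 0 x.
Proof. intros H. exists nil. simpl. rewrite invg1, gmul1x. repeat split; [constructor|easy|easy]. Qed.

Lemma level_len_in_gamma i n x : level_len i n x -> gamma G i x.
Proof.
  intros (w & H1 & _ & H3). rewrite <- (mulVKg _ (ev w) x). apply gamma_mul.
  - now apply ev_gamma, level_eq_ge.
  - now apply gamma_S.
Qed.

Lemma level_len_congr i n x y : gamma G (S i) (x^-1 ** y) -> level_len i n x -> level_len i n y.
Proof.
  intros H (w & H1 & H2 & H3). exists w. repeat split; [easy|easy|].
  replace ((ev w)^-1 ** y) with ((ev w)^-1 ** x ** (x^-1 ** y)) by grp.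
  now apply (gamma_mul _ (S i)).
Qed.

Lemma level_len_mul i n m x y : level_len i n x -> level_len i m y -> level_len i (n + m) (x ** y).
Proof.
  intros (w & H1 & H2 & H3) (v & H4 & H5 & H6). exists (w ++ v). repeat split.
  - now apply Forall_app.
  - rewrite length_app. lia.
  - rewrite ev_app.
    replace ((ev w ** ev v)^-1 ** (x ** y))
      with (conjg ((ev w)^-1 ** x) (ev v) ** ((ev v)^-1 ** y)) by grp.
    apply (gamma_mul _ (S i)); [|easy]. now apply (gamma_conj _ (S i)).
Qed.

Lemma level_len_inv i n x : level_len i n x -> level_len i n x^-1.
Proof.
  intros (w & H1 & H2 & H3). exists (winv w). repeat split.
  - now apply winv_Forall.
  - now rewrite winv_length.
  - rewrite ev_winv.
    replace ((ev w)^-1^-1 ** x^-1) with (conjg ((ev w)^-1 ** x)^-1 (ev w)^-1) by grp.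
    now apply (gamma_conj _ (S i)), (gamma_inv _ (S i)).
Qed.

Lemma level_len_conj i n x g : level_len i n x -> level_len i n (conjg x g).
Proof.
  intros H. apply (level_len_congr _ _ x); [|easy].
  replace (x^-1 ** conjg x g) with [~ x, g] by grp.
  now apply gamma_comm, level_len_in_gamma with n.
Qed.

Lemma level_len_letter l : level_len (lev l) 1 (lv l).
Proof.
  exists (l :: nil). repeat split.
  - now constructor.
  - easy.
  - simpl. rewrite gmulx1, gmulVx. apply (gamma_one _ (S (lev l))).
Qed.

Lemma level_len_one i n : level_len i n gone.
Proof. apply (level_len_le _ 0); [lia|]. apply level_len_gamma, (gamma_one _ (S i)). Qed.

Hypothesis U_comm : forall i t s, exists b, [~ U i t, U 0 s] = U (S i) b.

Lemma level_len_comm_letters l m : lev m = 0%nat -> level_len (S (lev l)) 1 [~ lv l, lv m].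
Proof.
  destruct l as [bl [i t]], m as [bm [j s]]. unfold lev. simpl. intros ->.
  destruct (U_comm i t s) as [b Hb].
  assert (H0 : level_len (S i) 1 [~ U i t, U 0 s]).
  { rewrite Hb. apply (level_len_letter (false, (S i, b))). }
  assert (H1 : level_len (S i) 1 [~ (U i t)^-1, U 0 s]).
  { replace [~ (U i t)^-1, U 0 s] with (conjg [~ U i t, U 0 s]^-1 (U i t)^-1) by grp.
    now apply level_len_conj, level_len_inv. }
  assert (HV : forall x, level_len (S i) 1 [~ x, U 0 s] -> level_len (S i) 1 [~ x, (U 0 s)^-1]).
  { intros x Hx. replace [~ x, (U 0 s)^-1] with (conjg [~ x, U 0 s]^-1 (U 0 s)^-1) by grp.
    now apply level_len_conj, level_len_inv. }
  destruct bl, bm; unfold lv; simpl; auto.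
Qed.

(** Commutation is bilinear from levels i and 0 to level i+1, so words of p and q letters give pq
    commutators of letters. There is no constant, which keeps iterated use exact. *)
Lemma level_len_comm i p q x g : level_len i p x -> level_len 0 q g -> level_len (S i) (p * q) [~ x, g].
Proof.
  intros Hx (v & V1 & V2 & V3). pose proof (level_len_in_gamma _ _ _ Hx) as Hxg.
  destruct Hx as (w & W1 & W2 & W3).
  assert (H0 : forall l, lev l = i -> level_len (S i) (length v) [~ lv l, ev v]).
  { intros l Hl. clear V2 V3. induction V1 as [|m v Hm Hv IH]; simpl.
    - replace [~ lv l, gone] with (gone : G) by grp. apply level_len_one.
    - replace [~ lv l, lv m ** ev v] with ([~ lv l, ev v] ** conjg [~ lv l, lv m] (ev v)) by grp.
      replace (S (length v)) with (length v + 1)%nat by lia.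
      apply level_len_mul; [easy|]. apply level_len_conj. subst i. now apply level_len_comm_letters. }
  assert (H1 : level_len (S i) (length w * length v) [~ ev w, ev v]).
  { clear W2 W3 V2 V3. induction W1 as [|l w Hl Hw IH]; simpl.
    - replace [~ gone, ev v] with (gone : G) by grp. apply level_len_one.
    - replace [~ lv l ** ev w, ev v] with (conjg [~ lv l, ev v] (ev w) ** [~ ev w, ev v]) by grp.
      apply level_len_mul; [now apply level_len_conj, H0|easy]. }
  apply (level_len_le _ (length w * length v)); [now apply Nat.mul_le_mono|].
  set (z := (ev w)^-1 ** x) in W3. set (z' := (ev v)^-1 ** g) in V3.
  assert (Ex : x = ev w ** z) by (unfold z; grp).
  assert (Eg : g = ev v ** z') by (unfold z'; grp).
  (* The parts z of x and z' of g that the words do not see contribute commutators lying in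
     [gamma (i+2)]. *)
  replace [~ x, g] with ([~ x, z'] ** conjg ([~ ev w, ev v] ** ([~ ev w, ev v]^-1 ** [~ x, ev v])) z')
    by (rewrite Eg; grp).
  apply (level_len_mul (S i) 0 (length w * length v)).
  - apply level_len_gamma. replace (S (S i)) with (S (i + 1)) by lia. now apply gamma_comm_gamma.
  - apply level_len_conj. rewrite mulVKg, Ex.
    replace [~ ev w ** z, ev v] with (conjg [~ ev w, ev v] z ** [~ z, ev v]) by grp.
    apply (level_len_le _ (length w * length v + 0)); [lia|].
    apply level_len_mul; [now apply level_len_conj|]. now apply level_len_gamma, gamma_comm.
Qed.

Hypothesis U_gen : forall x, exists n, level_len 0 n x.

Lemma gamma_level_len i x : gamma G i x -> exists n, level_len i n x.
Proof.
  revert x. induction i as [|i IH]; [intros x _; apply U_gen|]. apply gamma_ind.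
  - exists 0%nat. apply level_len_one.
  - intros x y _ [n Hx] _ [m Hy]. exists (n + m)%nat. now apply level_len_mul.
  - intros x _ [n Hx]. exists n. now apply level_len_inv.
  - intros x g Hx. destruct (IH x Hx) as [n Hn], (U_gen g) as [m Hm].
    exists (n * m)%nat. now apply level_len_comm.
Qed.

Variable c : nat.
Hypothesis gamma_c : forall x, gamma G c x -> x = gone.

(** Once the letters of level i are split off, the remainder lies one term deeper; the descent ends
    at the term [c], which is trivial. *)
Lemma gamma_word i x : gamma G i x -> exists w, level_ge i w /\ ev w = x.
Proof.
  intros Hx. destruct (Nat.lt_ge_cases c i) as [Hc|Hc].
  { exists nil. split; [constructor|]. symmetry.
    apply gamma_c. apply (gamma_le _ _ i); [lia|easy]. }
  remember (c - i)%nat as n eqn:En. revert i x Hx Hc En.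
  induction n as [|n IH]; intros i x Hx Hc En.
  - exists nil. split; [constructor|]. symmetry. apply gamma_c. now replace c with i by lia.
  - destruct (gamma_level_len i x Hx) as [p (w & W1 & _ & W3)].
    destruct (IH (S i) _ W3) as (v & V1 & V2); [lia|lia|].
    exists (w ++ v). split.
    + apply level_ge_app; [now apply level_eq_ge|]. revert V1. apply level_ge_le. lia.
    + rewrite ev_app, V2. grp.
Qed.

Variable d : nat.
Hypothesis U_trivial : forall i t, (c <= i \/ d <= t)%nat -> U i t = gone.

(** Only finitely many letters are nontrivial, so one D serves all pairs. Collection knows the
    commutation relations only through this D. *)
Lemma comm_letters_bound : exists D, forall l m, exists w,
  level_ge (S (lev l + lev m)) w /\ (length w <= D)%nat /\ ev w = [~ lv l, lv m].
Proof.
  assert (H : forall bl bm, exists D, forall i t j s, exists w,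
    level_ge (S (i + j)) w /\ (length w <= D)%nat
      /\ ev w = [~ lv (bl, (i, t)), lv (bm, (j, s))]).
  { intros bl bm.
    assert (Htriv : forall b i t, (c <= i \/ d <= t)%nat -> lv (b, (i, t)) = gone).
    { intros b i t Hit. unfold lv. simpl. rewrite U_trivial by easy.
      destruct b; [apply invg1|easy]. }
    apply (uniform_bound2 c d (fun i t n => forall j s, exists w,
      level_ge (S (i + j)) w /\ (length w <= n)%nat
      /\ ev w = [~ lv (bl, (i, t)), lv (bm, (j, s))])).
    - intros i t n m Hnm Hn j s. destruct (Hn j s) as (w & H1 & H2 & H3).
      exists w. repeat split; [easy|lia|easy].
    - intros i t. apply (uniform_bound2 c d (fun j s n => exists w,
        level_ge (S (i + j)) w /\ (length w <= n)%nat
        /\ ev w = [~ lv (bl, (i, t)), lv (bm, (j, s))])).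
      + intros j s n m Hnm (w & H1 & H2 & H3).
        exists w. repeat split; [easy|lia|easy].
      + intros j s. destruct (gamma_word (S (i + j)) [~ lv (bl, (i, t)), lv (bm, (j, s))])
          as (w & H1 & H2).
        * apply gamma_comm_gamma; apply (lv_gamma (_, (_, _))).
        * exists (length w), w. repeat split; easy.
      + intros j s Hjs. exists nil. repeat split; [constructor|easy|].
        rewrite (Htriv bm) by easy. grp.
    - intros i t Hit j s. exists nil. repeat split; [constructor|easy|].
      rewrite (Htriv bl) by easy. grp. }
  destruct (H true true) as [D1 H1], (H true false) as [D2 H2],
    (H false true) as [D3 H3], (H false false) as [D4 H4].
  exists (D1 + D2 + D3 + D4)%nat. intros [[|] [i t]] [[|] [j s]]; unfold lev; simpl.
  - destruct (H1 i t j s) as (w & ? & ? & ?). exists w. repeat split; [easy|lia|easy].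
  - destruct (H2 i t j s) as (w & ? & ? & ?). exists w. repeat split; [easy|lia|easy].
  - destruct (H3 i t j s) as (w & ? & ? & ?). exists w. repeat split; [easy|lia|easy].
  - destruct (H4 i t j s) as (w & ? & ? & ?). exists w. repeat split; [easy|lia|easy].
Qed.

End Alphabet.

(* Taking [r = 1/n], a word with at most [n^(i+1)] letters of each level [i] has bounded weight;
   conversely weight [t] allows at most [t n^(i+1)] letters of level [i]. *)
Definition wt (r : R) (w : list letter) : R :=
  fold_right (fun l a => r ^ S (lev l) + a) 0 w.

Definition lexpo (k : nat) (l : letter) (i : nat) : Z :=
  if andb (Nat.eqb (lev l) k) (Nat.eqb (snd (snd l)) i)
  then (if fst l then -1 else 1)%Z else 0%Z.

Definition expo (k : nat) (w : list letter) (i : nat) : Z :=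
  fold_right (fun l a => (lexpo k l i + a)%Z) 0%Z w.

Definition power_word (k i : nat) (z : Z) : list letter :=
  repeat ((z <? 0)%Z, (k, i)) (Z.abs_nat z).

Fixpoint normal_word (k d : nat) (a : nat -> Z) : list letter :=
  match d with
  | O => nil
  | S d => normal_word k d a ++ power_word k d (a d)
  end.

Fixpoint norm1 (d : nat) (a : nat -> Z) : Z :=
  match d with
  | O => 0%Z
  | S d => (norm1 d a + Z.abs (a d))%Z
  end.

Lemma wt_app r v w : wt r (v ++ w) = wt r v + wt r w.
Proof. induction v as [|l v IH]; simpl; [lra|]. rewrite IH. lra. Qed.

Lemma wt_nonneg r w : 0 <= r -> 0 <= wt r w.
Proof.
  intros Hr. induction w as [|l w IH]; [simpl; lra|].
  change (0 <= r ^ S (lev l) + wt r w). pose proof (pow_le r (S (lev l)) Hr). lra.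
Qed.

Lemma wt_winv r w : wt r (winv w) = wt r w.
Proof.
  unfold winv. induction w as [|l w IH]; simpl; [lra|].
  rewrite map_app, wt_app, IH. simpl. unfold linv, lev. simpl. lra.
Qed.

Lemma pow_le_pow_dec r m n : 0 <= r <= 1 -> (m <= n)%nat -> r ^ n <= r ^ m.
Proof.
  intros Hr H. replace n with (m + (n - m))%nat by lia. rewrite pow_add.
  assert (H1 : r ^ (n - m) <= 1 ^ (n - m)) by now apply pow_incr.
  rewrite pow1 in H1. pose proof (pow_le r m (proj1 Hr)). nra.
Qed.

Lemma wt_le_length r k w : 0 <= r <= 1 -> level_ge k w -> wt r w <= INR (length w) * r ^ S k.
Proof.
  intros Hr. induction 1 as [|l w Hl Hw IH]; [simpl; lra|].
  change (r ^ S (lev l) + wt r w <= INR (S (length w)) * r ^ S k).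
  rewrite S_INR. assert (r ^ S (lev l) <= r ^ S k) by (apply pow_le_pow_dec; [easy|lia]). lra.
Qed.

Lemma wt_level_eq r k w : level_eq k w -> wt r w = INR (length w) * r ^ S k.
Proof.
  induction 1 as [|l w Hl Hw IH]; [simpl; lra|].
  change (r ^ S (lev l) + wt r w = INR (S (length w)) * r ^ S k).
  rewrite S_INR, Hl. lra.
Qed.

Lemma expo_cons k l w i : expo k (l :: w) i = (lexpo k l i + expo k w i)%Z.
Proof. reflexivity. Qed.

Lemma expo_app k v w i : expo k (v ++ w) i = (expo k v i + expo k w i)%Z.
Proof.
  induction v as [|l v IH]; [easy|].
  rewrite <- app_comm_cons, !expo_cons, IH. lia.
Qed.

Lemma lexpo_linv k l i : lexpo k (linv l) i = (- lexpo k l i)%Z.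
Proof.
  unfold lexpo, linv, lev. simpl. destruct (_ && _)%bool, (fst l); easy.
Qed.

Lemma expo_winv k w i : expo k (winv w) i = (- expo k w i)%Z.
Proof.
  unfold winv. induction w as [|l w IH]; [easy|].
  simpl rev. rewrite map_app, expo_app, IH, expo_cons. simpl map.
  rewrite expo_cons, lexpo_linv. simpl. lia.
Qed.

Lemma lexpo_level k l i : lev l <> k -> lexpo k l i = 0%Z.
Proof. intros H. unfold lexpo. now apply Nat.eqb_neq in H as ->. Qed.

Lemma expo_high k w i : level_ge (S k) w -> expo k w i = 0%Z.
Proof.
  induction 1 as [|l w Hl Hw IH]; [easy|]. rewrite expo_cons, IH, lexpo_level; lia.
Qed.

Lemma power_word_length k i z : length (power_word k i z) = Z.abs_nat z.
Proof. apply repeat_length. Qed.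

Lemma power_word_level k i z : level_eq k (power_word k i z).
Proof. apply Forall_forall. intros l H. apply repeat_spec in H. now subst l. Qed.

Lemma normal_word_level k d a : level_eq k (normal_word k d a).
Proof.
  induction d as [|d IH]; simpl; [constructor|].
  apply Forall_app. split; [easy|apply power_word_level].
Qed.

Lemma normal_word_length k d a : INR (length (normal_word k d a)) = IZR (norm1 d a).
Proof.
  induction d as [|d IH]; simpl; [easy|].
  rewrite length_app, plus_INR, plus_IZR, IH, power_word_length, INR_IZR_INZ.
  now rewrite Zabs2Nat.id_abs.
Qed.

Lemma normal_word_wt r k d a : wt r (normal_word k d a) = IZR (norm1 d a) * r ^ S k.
Proof. rewrite (wt_level_eq _ k), normal_word_length; [easy|apply normal_word_level]. Qed.

Lemma normal_word_ext k d a b : (forall i, (i < d)%nat -> a i = b i) ->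
  normal_word k d a = normal_word k d b.
Proof.
  induction d as [|d IH]; simpl; intros H; [easy|].
  rewrite IH, H; [easy|lia|]. intros i Hi. apply H. lia.
Qed.

Lemma norm1_ext d a b : (forall i, (i < d)%nat -> a i = b i) -> norm1 d a = norm1 d b.
Proof.
  induction d as [|d IH]; simpl; intros H; [easy|].
  rewrite IH, H; [easy|lia|]. intros i Hi. apply H. lia.
Qed.

Lemma norm1_nonneg d a : (0 <= norm1 d a)%Z.
Proof. induction d as [|d IH]; simpl; lia. Qed.

Lemma norm1_add d a b : (norm1 d (fun i => a i + b i) <= norm1 d a + norm1 d b)%Z.
Proof. induction d as [|d IH]; simpl; lia. Qed.

Lemma expo_power_word k i z j :
  expo k (power_word k i z) j = if Nat.eqb i j then z else 0%Z.
Proof.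
  unfold power_word.
  assert (H : forall b n, expo k (repeat (b, (k, i)) n) j
    = if Nat.eqb i j then if b then (- Z.of_nat n)%Z else Z.of_nat n else 0%Z).
  { intros b n. induction n as [|n IH]; [simpl; now destruct (Nat.eqb i j), b|].
    change (lexpo k (b, (k, i)) j + expo k (repeat (b, (k, i)) n) j
      = if Nat.eqb i j then if b then - Z.of_nat (S n) else Z.of_nat (S n) else 0)%Z.
    rewrite IH. unfold lexpo, lev. simpl fst. simpl snd. rewrite Nat.eqb_refl. simpl andb.
    destruct (Nat.eqb i j), b; lia. }
  rewrite H. destruct (Nat.eqb i j); [|easy].
  destruct (Z.ltb_spec z 0); lia.
Qed.

Lemma expo_normal_word k d a i :
  expo k (normal_word k d a) i = if Nat.ltb i d then a i else 0%Z.
Proof.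
  induction d as [|d IH]; [easy|]. simpl normal_word.
  rewrite expo_app, IH, expo_power_word.
  destruct (Nat.ltb_spec i d), (Nat.ltb_spec i (S d)), (Nat.eqb_spec d i); subst; lia.
Qed.

Lemma norm1_lexpo d k l :
  (norm1 d (lexpo k l) <= if Nat.eqb (lev l) k then 1 else 0)%Z.
Proof.
  (* The second clause tells the induction that the coordinates before the index of l vanish, so
     that only one of them counts. *)
  cut ((norm1 d (lexpo k l) <= if Nat.eqb (lev l) k then 1 else 0)%Z
    /\ ((d <= snd (snd l))%nat -> norm1 d (lexpo k l) = 0%Z)); [easy|].
  induction d as [|d [IH1 IH2]]; simpl norm1.
  - now destruct (Nat.eqb (lev l) k).
  - unfold lexpo at 2 4. destruct (Nat.eqb (lev l) k); simpl andb.
    + destruct (Nat.eqb_spec (snd (snd l)) d), (fst l); split; intros; lia.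
    + split; intros; lia.
Qed.

Lemma norm1_expo_le r k d w : 0 <= r -> IZR (norm1 d (expo k w)) * r ^ S k <= wt r w.
Proof.
  intros Hr. pose proof (pow_le r (S k) Hr) as Hk.
  induction w as [|l w IH].
  - assert (H : norm1 d (expo k nil) = 0%Z) by (clear; induction d; simpl in *; lia).
    rewrite H. simpl; lra.
  - change (wt r (l :: w)) with (r ^ S (lev l) + wt r w).
    pose proof (pow_le r (S (lev l)) Hr) as Hl.
    pose proof (norm1_add d (lexpo k l) (expo k w)) as H. apply IZR_le in H.
    change (fun i => (lexpo k l i + expo k w i)%Z) with (expo k (l :: w)) in H.
    rewrite plus_IZR in H.
    pose proof (norm1_lexpo d k l) as H1. apply IZR_le in H1.
    destruct (Nat.eqb_spec (lev l) k) as [->|_]; nra.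
Qed.

(** * Collection *)

Section Collect.
Variable G : group.
Variable U : nat -> nat -> G.
Variable r : R.

(** The exponent sums at the lowest level k are recorded next to the weight, because the value x
    does not determine them when the letters satisfy relations. [wword] forgets them. *)
Definition wexpo (k : nat) (a : nat -> Z) (t : R) (x : G) : Prop :=
  exists w, level_ge k w /\ wt r w <= t /\ (forall i, expo k w i = a i) /\ ev G U w = x.

Definition wword (k : nat) (t : R) (x : G) : Prop :=
  exists w, level_ge k w /\ wt r w <= t /\ ev G U w = x.

Definition normal (k d : nat) (a : nat -> Z) : G := ev G U (normal_word k d a).

Lemma wexpo_wword k a t x : wexpo k a t x -> wword k t x.
Proof. intros (w & H1 & H2 & _ & H4). now exists w. Qed.

Lemma wword_le k t s x : t <= s -> wword k t x -> wword k s x.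
Proof. intros Hts (w & H1 & H2 & H3). exists w. repeat split; [easy|lra|easy]. Qed.

Lemma wexpo_le k a t s x : t <= s -> wexpo k a t x -> wexpo k a s x.
Proof. intros Hts (w & H1 & H2 & H3). exists w. repeat split; [easy|lra|easy|easy]. Qed.

Lemma wword_level j k t x : (j <= k)%nat -> wword k t x -> wword j t x.
Proof.
  intros Hjk (w & H1 & H2 & H3). exists w. repeat split; [|easy|easy].
  revert H1. now apply level_ge_le.
Qed.

Lemma wexpo_ext k a b t x : (forall i, a i = b i) -> wexpo k a t x -> wexpo k b t x.
Proof.
  intros H (w & H1 & H2 & H3 & H4). exists w. repeat split; [easy|easy| |easy].
  intros i. now rewrite H3.
Qed.

Lemma wexpo_mul k a b t s x y :
  wexpo k a t x -> wexpo k b s y -> wexpo k (fun i => (a i + b i)%Z) (t + s) (x ** y).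
Proof.
  intros (w & H1 & H2 & H3 & H4) (v & K1 & K2 & K3 & K4). exists (w ++ v). repeat split.
  - now apply level_ge_app.
  - rewrite wt_app. lra.
  - intros i. now rewrite expo_app, H3, K3.
  - now rewrite ev_app, H4, K4.
Qed.

Lemma wword_mul k t s x y : wword k t x -> wword k s y -> wword k (t + s) (x ** y).
Proof.
  intros (w & H1 & H2 & H3) (v & K1 & K2 & K3). exists (w ++ v). repeat split.
  - now apply level_ge_app.
  - rewrite wt_app. lra.
  - now rewrite ev_app, H3, K3.
Qed.

Lemma wexpo_inv k a t x : wexpo k a t x -> wexpo k (fun i => (- a i)%Z) t x^-1.
Proof.
  intros (w & H1 & H2 & H3 & H4). exists (winv w). repeat split.
  - now apply winv_Forall.
  - now rewrite wt_winv.
  - intros i. now rewrite expo_winv, H3.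
  - now rewrite ev_winv, H4.
Qed.

Lemma wword_inv k t x : wword k t x -> wword k t x^-1.
Proof.
  intros (w & H1 & H2 & H3). exists (winv w). repeat split.
  - now apply winv_Forall.
  - now rewrite wt_winv.
  - now rewrite ev_winv, H3.
Qed.

Lemma wword_one k t : 0 <= t -> wword k t gone.
Proof. intros Ht. exists nil. repeat split; [constructor|easy]. Qed.

Lemma wexpo_one k t : 0 <= t -> wexpo k (fun _ => 0%Z) t gone.
Proof. intros Ht. exists nil. repeat split; [constructor|easy]. Qed.

Lemma wexpo_normal k d a : (forall i, (d <= i)%nat -> a i = 0%Z) ->
  wexpo k a (IZR (norm1 d a) * r ^ S k) (normal k d a).
Proof.
  intros Ha. exists (normal_word k d a). repeat split.
  - apply level_eq_ge, normal_word_level.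
  - rewrite normal_word_wt. lra.
  - intros i. rewrite expo_normal_word.
    destruct (Nat.ltb_spec i d); [easy|]. now rewrite Ha.
Qed.

Variables d D : nat.
Hypothesis r_range : 0 <= r <= 1.
Hypothesis U_trivial : forall i t, (d <= t)%nat -> U i t = gone.
Hypothesis U_bound : forall l m, exists w, level_ge (S (lev l + lev m)) w
  /\ (length w <= D)%nat /\ ev G U w = [~ lv G U l, lv G U m].

(** Weights multiply under commutators: letters of levels i and j give letters of level at least
    i+j+1, and (i+1) + (j+1) = (i+j+1) + 1. *)
Lemma wword_comm_letters l m :
  wword (S (lev l + lev m)) (INR D * r ^ S (lev l) * r ^ S (lev m)) [~ lv G U l, lv G U m].
Proof.
  destruct (U_bound l m) as (w & H1 & H2 & H3). exists w. repeat split; [easy| |easy].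
  apply (wt_le_length r) in H1; [|easy].
  apply le_INR in H2. replace (S (S (lev l + lev m))) with (S (lev l) + S (lev m))%nat in H1 by lia.
  rewrite pow_add in H1.
  pose proof (pow_le r (S (lev l)) (proj1 r_range)).
  pose proof (pow_le r (S (lev m)) (proj1 r_range)).
  assert (0 <= r ^ S (lev l) * r ^ S (lev m)) by now apply Rmult_le_pos.
  nra.
Qed.

(** Each letter l becomes l[l, m]. The correction weighs at most D r^(lev m + 1) times as much as l,
    and its level exceeds k, so the exponent sums at level k do not change. *)
Lemma conj_letter k w m : level_ge k w ->
  exists v, level_ge k v /\ wt r v <= wt r w * (1 + INR D * r ^ S (lev m))
    /\ (forall i, expo k v i = expo k w i) /\ ev G U v = conjg (ev G U w) (lv G U m).
Proof.
  induction 1 as [|l w Hl Hw (v & V1 & V2 & V3 & V4)].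
  - exists nil. repeat split; [constructor|simpl; lra|]. simpl. grp.
  - destruct (wword_comm_letters l m) as (u & U1 & U2 & U3).
    exists ((l :: u) ++ v). repeat split.
    + constructor; [easy|]. apply level_ge_app; [|easy]. revert U1. apply level_ge_le. lia.
    + rewrite wt_app.
      change (r ^ S (lev l) + wt r u + wt r v
        <= (r ^ S (lev l) + wt r w) * (1 + INR D * r ^ S (lev m))). nra.
    + intros i. rewrite expo_app, !expo_cons, V3, (expo_high k u); [lia|].
      revert U1. apply level_ge_le. lia.
    + rewrite ev_app, !ev_cons, U3, V4. grp.
Qed.

(** The factors 1 + D r^(lev m + 1), over the letters m of v, multiply to at most exp(D wt v). The
    cost depends on the weight of v and not on its number of letters. *)
Lemma wexpo_conj k a t x v :
  wexpo k a t x -> wexpo k a (t * exp (INR D * wt r v)) (conjg x (ev G U v)).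
Proof.
  revert t x. induction v as [|m v IH]; intros t x Hx.
  - simpl. rewrite Rmult_0_r, exp_0, Rmult_1_r.
    replace (conjg x gone) with x by grp. easy.
  - change (wt r (m :: v)) with (r ^ S (lev m) + wt r v). rewrite ev_cons.
    replace (conjg x (lv G U m ** ev G U v)) with (conjg (conjg x (lv G U m)) (ev G U v)) by grp.
    rewrite Rmult_plus_distr_l, exp_plus, <- Rmult_assoc. apply IH.
    destruct Hx as (w & H1 & H2 & H3 & H4).
    destruct (conj_letter k w m H1) as (u & U1 & U2 & U3 & U4).
    exists u. repeat split; [easy| | |].
    + pose proof (exp_ineq1_le (INR D * r ^ S (lev m))) as He.
      pose proof (wt_nonneg r w (proj1 r_range)).
      assert (0 <= INR D * r ^ S (lev m))
        by (apply Rmult_le_pos; [apply pos_INR|apply pow_le, r_range]).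
      apply (Rle_trans _ _ _ U2). apply Rmult_le_compat; lra.
    + intros i. now rewrite U3.
    + now rewrite U4, H4.
Qed.

Lemma wword_conj k t x v :
  wword k t x -> wword k (t * exp (INR D * wt r v)) (conjg x (ev G U v)).
Proof.
  intros (w & H1 & H2 & H3).
  apply (wexpo_wword k (expo k w)). apply wexpo_conj. now exists w.
Qed.

Lemma exp_mono_le x y : x <= y -> exp x <= exp y.
Proof. intros [H| ->]; [left; now apply exp_increasing|right; easy]. Qed.

Lemma wword_comm_letter l v s : wt r v <= s ->
  wword (S (lev l)) (INR D * s * exp (INR D * s) * r ^ S (lev l)) [~ lv G U l, ev G U v].
Proof.
  intros Hs.
  (* From [l, mv] = [l, v] [l, m]^v. The linear factor follows v while the exponential one stays
     fixed at s; with s in both places the induction would not close. *)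
  assert (H : wword (S (lev l)) (INR D * wt r v * exp (INR D * s) * r ^ S (lev l))
                [~ lv G U l, ev G U v]).
  { pose proof (pow_le r (S (lev l)) (proj1 r_range)) as Hl.
    pose proof (pos_INR D) as HD.
    induction v as [|m v IH].
    - replace [~ lv G U l, ev G U nil] with (gone : G) by (simpl; grp).
      apply wword_one. simpl. lra.
    - change (wt r (m :: v)) with (r ^ S (lev m) + wt r v) in *.
      pose proof (pow_le r (S (lev m)) (proj1 r_range)) as Hm.
      rewrite ev_cons.
      replace [~ lv G U l, lv G U m ** ev G U v]
        with ([~ lv G U l, ev G U v] ** conjg [~ lv G U l, lv G U m] (ev G U v)) by grp.
      eapply wword_le; [|apply wword_mul; [apply IH; lra|apply wword_conj]].
      2:{ apply (wword_level _ (S (lev l + lev m))); [lia|]. apply wword_comm_letters. }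
      assert (He : exp (INR D * wt r v) <= exp (INR D * s)) by (apply exp_mono_le; nra).
      assert (0 <= INR D * r ^ S (lev l) * r ^ S (lev m))
        by (apply Rmult_le_pos; [apply Rmult_le_pos|]; easy).
      nra. }
  revert H. apply wword_le. apply Rmult_le_compat_r; [apply pow_le, r_range|].
  apply Rmult_le_compat_r; [left; apply exp_pos|].
  apply Rmult_le_compat_l; [apply pos_INR|easy].
Qed.

Lemma ev_power_word_succ k i b z :
  lv G U (b, (k, i)) ** ev G U (power_word k i z)
  = ev G U (power_word k i ((if b then -1 else 1) + z)).
Proof.
  assert (Hrep : forall b n, lv G U (b, (k, i)) ** ev G U (repeat (b, (k, i)) n)
    = ev G U (repeat (b, (k, i)) (S n))) by reflexivity.
  unfold power_word. destruct b; destruct (Z.ltb_spec z 0) as [Hz|Hz].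
  - destruct (Z.ltb_spec (-1 + z) 0); [|lia].
    replace (Z.abs_nat (-1 + z)) with (S (Z.abs_nat z)) by lia. apply Hrep.
  - destruct (Z.ltb_spec (-1 + z) 0).
    + replace z with 0%Z by lia. reflexivity.
    + replace (Z.abs_nat z) with (S (Z.abs_nat (-1 + z))) by lia.
      rewrite <- Hrep. unfold lv. simpl fst. grp.
  - destruct (Z.ltb_spec (1 + z) 0).
    + replace (Z.abs_nat z) with (S (Z.abs_nat (1 + z))) by lia.
      rewrite <- Hrep. unfold lv. simpl fst. grp.
    + replace z with (-1)%Z by lia. simpl. unfold lv. simpl. grp.
  - destruct (Z.ltb_spec (1 + z) 0); [lia|].
    replace (Z.abs_nat (1 + z)) with (S (Z.abs_nat z)) by lia. apply Hrep.
Qed.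

(** The normal word is cut at the place of the letter l: inserting l there turns pq into plq. *)
Lemma normal_insert k l a : lev l = k -> (snd (snd l) < d)%nat ->
  exists p q, normal k d a = ev G U p ** ev G U q
    /\ normal k d (fun i => (lexpo k l i + a i)%Z) = ev G U p ** lv G U l ** ev G U q
    /\ wt r p <= IZR (norm1 d a) * r ^ S k /\ wt r q <= IZR (norm1 d a) * r ^ S k.
Proof.
  intros Hl. pose proof (pow_le r (S k) (proj1 r_range)) as Hk.
  unfold normal. generalize d at 1 2 3 4 5. intros e.
  induction e as [|e IH]; intros He; [lia|]. simpl normal_word. simpl norm1.
  pose proof (norm1_nonneg e a) as Hn. apply IZR_le in Hn.
  assert (Hp : forall z, wt r (power_word k e z) = IZR (Z.abs z) * r ^ S k).
  { intros z. rewrite (wt_level_eq _ k) by apply power_word_level.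
    now rewrite power_word_length, INR_IZR_INZ, Zabs2Nat.id_abs. }
  assert (Ha : 0 <= IZR (Z.abs (a e))) by (apply IZR_le; lia).
  rewrite plus_IZR.
  destruct (Nat.eq_dec (snd (snd l)) e) as [Ee|Hne].
  - exists (normal_word k e a), (power_word k e (a e)). rewrite !ev_app. repeat split.
    + rewrite <- gmulA. f_equal.
      * f_equal. apply normal_word_ext. intros i Hi. unfold lexpo.
        destruct (Nat.eqb_spec (snd (snd l)) i); [lia|]. now rewrite Bool.andb_false_r.
      * destruct l as [b [k' i]]. unfold lev in Hl. simpl in Hl, Ee. subst k' i.
        rewrite ev_power_word_succ. f_equal. f_equal. unfold lexpo, lev. simpl.
        now rewrite !Nat.eqb_refl.
    + rewrite normal_word_wt. nra.
    + rewrite Hp. nra.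
  - destruct IH as (p & q & H1 & H2 & H3 & H4); [lia|].
    exists p, (q ++ power_word k e (a e)). rewrite !ev_app, H1, H2. repeat split.
    + now rewrite gmulA.
    + rewrite !gmulA. f_equal. f_equal. f_equal. unfold lexpo.
      destruct (Nat.eqb_spec (snd (snd l)) e); [lia|]. now rewrite Bool.andb_false_r.
    + nra.
    + rewrite wt_app, Hp. nra.
Qed.

(** Cost per unit of weight of collecting one letter in a word of weight at most t. The term exp(D
    t) is for a letter above level k, conjugated by a normal word; the term D t exp(D t)^2 is for a
    letter l of level k, which leaves [l, p] conjugated by q. The sum covers both cases. *)
Definition collect_factor (t : R) : R :=
  exp (INR D * t) * (1 + INR D * t * exp (INR D * t)).

(** Letters are absorbed starting from the right end. If E is the normal word of what has been
    absorbed, the next letter l, standing to the left of E, is inserted into E and leaves [l, p]^q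
    when its level is k; when it is deeper it moves to the right of E and leaves a conjugate. Each
    leftover is proportional to the weight of its own letter, so the total is linear in [wt r w]. *)
Lemma collect_word k t w : 0 <= t -> level_ge k w -> wt r w <= t ->
  wword (S k) (wt r w * collect_factor t) ((normal k d (expo k w))^-1 ** ev G U w).
Proof.
  intros Ht. pose proof (pos_INR D) as HD.
  assert (HDt : 0 <= INR D * t) by now apply Rmult_le_pos.
  pose proof (exp_ineq1_le (INR D * t)) as He.
  assert (Hf : exp (INR D * t) <= collect_factor t) by (unfold collect_factor; nra).
  induction 1 as [|l w Hl Hw IH]; intros Hwt.
  - replace (normal k d (expo k nil)) with (gone : G).
    + simpl. rewrite invg1, gmul1x. apply wword_one. lra.
    + unfold normal. clear. induction d as [|e IHe]; [easy|].
      simpl normal_word. rewrite ev_app, <- IHe. simpl. now rewrite gmul1x.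
  - change (wt r (l :: w)) with (r ^ S (lev l) + wt r w) in *.
    pose proof (pow_le r (S (lev l)) (proj1 r_range)) as Hl0.
    specialize (IH ltac:(lra)).
    set (a := expo k w) in *. set (E := normal k d a) in *.
    pose proof (norm1_expo_le r k d w (proj1 r_range)) as Hn. fold a in Hn.
    rewrite Rmult_plus_distr_r. rewrite ev_cons.
    destruct (Nat.eq_dec (lev l) k) as [Elk|Hne].
    + destruct (Nat.lt_ge_cases (snd (snd l)) d) as [Hi|Hi].
      * destruct (normal_insert k l a Elk Hi) as (p & q & H1 & H2 & H3 & H4).
        change (expo k (l :: w)) with (fun i => (lexpo k l i + a i)%Z).
        rewrite H2. fold E in H1.
        replace ((ev G U p ** lv G U l ** ev G U q)^-1 ** (lv G U l ** ev G U w))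
          with (conjg [~ lv G U l, ev G U p] (ev G U q) ** (E^-1 ** ev G U w))
          by (rewrite H1; grp).
        apply wword_mul; [|easy].
        eapply wword_le; [|apply wword_conj; rewrite <- Elk; apply (wword_comm_letter _ _ t); lra].
        assert (Hq : exp (INR D * wt r q) <= exp (INR D * t)) by (apply exp_mono_le; nra).
        unfold collect_factor.
        assert (0 <= INR D * t * exp (INR D * t) * r ^ S (lev l)).
        { apply Rmult_le_pos; [|easy]. apply Rmult_le_pos; [easy|]. left; apply exp_pos. }
        apply (Rle_trans _ (INR D * t * exp (INR D * t) * r ^ S (lev l) * exp (INR D * t)));
          [now apply Rmult_le_compat_l|].
        assert (0 <= r ^ S (lev l) * exp (INR D * t)) by nra. nra.
      * replace (lv G U l) with (gone : G).
        2:{ unfold lv. rewrite (U_trivial _ _ Hi). destruct (fst l); [now rewrite invg1|easy]. }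
        rewrite gmul1x.
        replace (normal k d (expo k (l :: w))) with E.
        -- revert IH. apply wword_le. nra.
        -- unfold E, normal. f_equal. apply normal_word_ext. intros i Hid.
           rewrite expo_cons. unfold lexpo.
           destruct (Nat.eqb_spec (snd (snd l)) i); [lia|]. now rewrite Bool.andb_false_r.
    + replace (normal k d (expo k (l :: w))) with E.
      2:{ unfold E, normal. f_equal. apply normal_word_ext. intros i Hid.
          now rewrite expo_cons, lexpo_level. }
      replace (E^-1 ** (lv G U l ** ev G U w))
        with (conjg (lv G U l) E ** (E^-1 ** ev G U w)) by grp.
      apply wword_mul; [|easy].
      eapply wword_le; [|unfold E, normal; apply wword_conj].
      2:{ exists (l :: nil). repeat split; [|apply Rle_refl|].
          - constructor; [lia|constructor].
          - simpl. apply gmulx1. }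
      simpl wt. rewrite Rplus_0_r.
      assert (Hq : exp (INR D * wt r (normal_word k d a)) <= exp (INR D * t)).
      { apply exp_mono_le. rewrite normal_word_wt. nra. }
      change (r * r ^ lev l) with (r ^ S (lev l)). nra.
Qed.

Lemma collect k a t x : 0 <= t -> wexpo k a t x ->
  wword (S k) (t * collect_factor t) ((normal k d a)^-1 ** x).
Proof.
  intros Ht (w & H1 & H2 & H3 & H4).
  replace (normal k d a) with (normal k d (expo k w)).
  - rewrite <- H4. pose proof (collect_word k t w Ht H1 H2) as H.
    revert H. apply wword_le. apply Rmult_le_compat_r; [|easy].
    unfold collect_factor. pose proof (pos_INR D).
    assert (0 <= INR D * t) by now apply Rmult_le_pos.
    pose proof (exp_pos (INR D * t)).
    apply Rmult_le_pos; [lra|]. assert (0 <= INR D * t * exp (INR D * t)) by nra. lra.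
  - unfold normal. f_equal. apply normal_word_ext. intros i _. apply H3.
Qed.

End Collect.

(** * Subgroups of Z^d *)

Section Lattice.
Local Open Scope Z_scope.

Definition vterm (p : bool * (nat -> Z)) (i : nat) : Z :=
  if fst p then - snd p i else snd p i.

Definition vsum (l : list (bool * (nat -> Z))) (i : nat) : Z :=
  fold_right (fun p acc => vterm p i + acc) 0 l.

Lemma vsum_app l m i : vsum (l ++ m) i = vsum l i + vsum m i.
Proof.
  unfold vsum. induction l as [|p l IH]; [easy|]. simpl. rewrite IH. lia.
Qed.

Definition truncate (d : nat) (a : nat -> Z) (i : nat) : Z := if Nat.ltb i d then a i else 0.

Lemma vsum_truncate d l i :
  vsum (map (fun p => (fst p, truncate d (snd p))) l) i = if Nat.ltb i d then vsum l i else 0.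
Proof.
  unfold vsum. induction l as [|[b a] l IH]; simpl.
  - now destruct (Nat.ltb i d).
  - rewrite IH. unfold vterm, truncate. simpl. destruct (Nat.ltb i d), b; lia.
Qed.

Lemma vsum_repeat q b i :
  vsum (repeat (q <? 0, b) (Z.abs_nat q)) i = q * b i.
Proof.
  assert (H : forall s n, vsum (repeat (s, b) n) i
    = if s : bool then - (Z.of_nat n * b i) else Z.of_nat n * b i).
  { intros s n. induction n as [|n IH]; [simpl; now destruct s|].
    change (vterm (s, b) i + vsum (repeat (s, b) n) i
      = if s then - (Z.of_nat (S n) * b i) else Z.of_nat (S n) * b i).
    rewrite IH. unfold vterm. simpl fst. simpl snd. destruct s; lia. }
  rewrite H. destruct (Z.ltb_spec q 0).
  - replace (Z.of_nat (Z.abs_nat q)) with (- q) by lia. lia.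
  - replace (Z.of_nat (Z.abs_nat q)) with q by lia. lia.
Qed.

Lemma norm1_scale d q b : norm1 d (fun i => q * b i) = Z.abs q * norm1 d b.
Proof. induction d as [|d IH]; simpl; [lia|]. rewrite IH, Z.abs_mul. lia. Qed.

(** Induction on d splits off the last coordinate: its values on L are multiples of a single one,
    and the elements where it vanishes form a lattice of smaller dimension. Vectors are functions
    read on their first d coordinates, whence the closure of L under agreement there. *)
Lemma lattice_basis d (L : (nat -> Z) -> Prop) :
  (forall a b, (forall i, (i < d)%nat -> a i = b i) -> L a -> L b) ->
  (forall a b, L a -> L b -> L (fun i => a i + b i)) ->
  (forall a, L a -> L (fun i => - a i)) ->
  exists (B : list (nat -> Z)) (C : nat), Forall L B /\
    forall a, L a -> exists l, Forall (fun p => In (snd p) B) l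
      /\ Z.of_nat (length l) <= Z.of_nat C * norm1 d a
      /\ forall i, (i < d)%nat -> vsum l i = a i.
Proof.
  revert L. induction d as [|d IH]; intros L Lext Ladd Lopp.
  { exists nil, 0%nat. split; [constructor|]. intros a _. exists nil.
    repeat split; [constructor|simpl; lia|lia]. }
  set (L' := fun a => L (truncate d a)).
  destruct (IH L') as (B & C & HB & HC).
  { intros a b Hab. apply Lext. intros i _. unfold truncate.
    destruct (Nat.ltb_spec i d); [now apply Hab|easy]. }
  { intros a b Ha Hb. refine (Lext _ _ _ (Ladd _ _ Ha Hb)). intros i _. unfold truncate.
    destruct (Nat.ltb_spec i d); lia. }
  { intros a Ha. refine (Lext _ _ _ (Lopp _ Ha)). intros i _. unfold truncate.
    destruct (Nat.ltb_spec i d); lia. }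
  set (B' := map (truncate d) B).
  assert (HB' : Forall L B') by now apply Forall_map.
  assert (Hred : forall a, L a -> a d = 0 -> exists l, Forall (fun p => In (snd p) B') l
      /\ Z.of_nat (length l) <= Z.of_nat C * norm1 d a
      /\ forall i, (i < S d)%nat -> vsum l i = a i).
  { intros a Ha Had. destruct (HC a) as (l & H1 & H2 & H3).
    { refine (Lext _ _ _ Ha). intros i Hi. unfold truncate.
      destruct (Nat.ltb_spec i d); [easy|]. now replace i with d by lia. }
    exists (map (fun p => (fst p, truncate d (snd p))) l). repeat split.
    - apply Forall_map. revert H1. apply Forall_impl. intros p Hp. now apply (in_map (truncate d)).
    - now rewrite length_map.
    - intros i Hi. rewrite vsum_truncate. destruct (Nat.ltb_spec i d); [now apply H3|].
      now replace i with d by lia. }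
  destruct (classic (exists n, (0 < n)%nat /\ exists b, L b /\ b d = Z.of_nat n)) as [Hex|Hno].
  - destruct Hex as [n0 Hn0].
    destruct (dec_inh_nat_subset_has_unique_least_element
      (fun n => (0 < n)%nat /\ exists b, L b /\ b d = Z.of_nat n)) as [n [[[Hn (b & Hb & Hbd)] Hmin] _]].
    { intros n. apply classic. }
    { now exists n0. }
    assert (Hnat : forall (m : nat), L (fun i => Z.of_nat m * b i)).
    { induction m as [|m IHm].
      - refine (Lext _ _ _ (Ladd _ _ Hb (Lopp _ Hb))). intros; lia.
      - refine (Lext _ _ _ (Ladd _ _ Hb IHm)). intros; lia. }
    assert (Hint : forall q, L (fun i => q * b i)).
    { intros q. destruct (Z.le_ge_cases 0 q).
      - refine (Lext _ _ _ (Hnat (Z.to_nat q))). intros; now rewrite Z2Nat.id.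
      - refine (Lext _ _ _ (Lopp _ (Hnat (Z.to_nat (- q))))). intros; rewrite Z2Nat.id; lia. }
    (* With q = a_d / b_d, the norm of a - qb on the first d coordinates is at most that of a plus
       |a_d| times that of b; the last 1 pays for the |q| copies of b. *)
    exists (b :: B'), (C * (1 + Z.to_nat (norm1 d b)) + 1)%nat. split; [now constructor|].
    intros a Ha. set (q := a d / b d).
    assert (Hr := Z.div_mod (a d) (b d) ltac:(lia)).
    assert (Hr' := Z.mod_pos_bound (a d) (b d) ltac:(lia)).
    assert (Ha' : L (fun i => a i + - q * b i)) by now apply Ladd.
    (* The remainder is itself the last coordinate of an element of L, and is smaller than the least
       positive one. *)
    assert (Hz : a d + - q * b d = 0).
    { destruct (Z.eq_dec (a d mod b d) 0) as [Hz|Hz]; [unfold q; lia|].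
      exfalso. enough (n <= Z.to_nat (a d mod b d))%nat by lia.
      apply Hmin. split; [lia|]. eexists. split; [apply Ha'|]. simpl. unfold q. lia. }
    assert (Hq : Z.abs q <= Z.abs (a d)) by nia.
    destruct (Hred _ Ha' Hz) as (l & H1 & H2 & H3).
    exists (l ++ repeat (q <? 0, b) (Z.abs_nat q)). repeat split.
    + apply Forall_app. split.
      * revert H1. apply Forall_impl. intros p Hp. now right.
      * apply Forall_forall. intros p Hp. apply repeat_spec in Hp. subst p. now left.
    + rewrite length_app, repeat_length.
      pose proof (norm1_add d a (fun i => - q * b i)) as Hn1. rewrite norm1_scale in Hn1.
      pose proof (norm1_nonneg d a). pose proof (norm1_nonneg d b).
      simpl norm1 in *.
      rewrite !Nat2Z.inj_add, Nat2Z.inj_mul, Nat2Z.inj_add, Z2Nat.id by easy.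
      rewrite Z.abs_opp in Hn1. rewrite Zabs2Nat.id_abs.
      set (A := norm1 d a) in *. set (N := norm1 d b) in *.
      set (M := norm1 d (fun i => a i + - q * b i)) in *.
      assert (Z.of_nat C * M <= Z.of_nat C * (A + Z.abs (a d) * N)).
      { apply Z.mul_le_mono_nonneg_l; [lia|]. nia. }
      assert (0 <= Z.of_nat C * (A * N)) by nia.
      assert (0 <= Z.of_nat C * Z.abs (a d)) by nia.
      nia.
    + intros i Hi. rewrite vsum_app, H3, vsum_repeat by easy. lia.
  - exists B', C. split; [easy|]. intros a Ha.
    assert (Had : a d = 0).
    { destruct (Z.lt_trichotomy (a d) 0) as [H|[H|H]]; [|easy|]; exfalso; apply Hno.
      - exists (Z.to_nat (- a d)). split; [lia|]. exists (fun i => - a i). split; [now apply Lopp|lia].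
      - exists (Z.to_nat (a d)). split; [lia|]. exists a. split; [easy|lia]. }
    destruct (Hred a Ha Had) as (l & H1 & H2 & H3). exists l. repeat split; [easy| |easy].
    simpl norm1. rewrite Had. simpl. now rewrite Z.add_0_r.
Qed.

End Lattice.

(** * Word length in nilpotent groups *)

Section Length.
Variable G : group.
Variable U : nat -> nat -> G.

(** Word length in the generators; unlike in [level_len] at level 0, the word represents x itself
    and not x modulo commutators. *)
Definition len0 (n : nat) (x : G) : Prop :=
  exists w, level_eq 0 w /\ (length w <= n)%nat /\ ev G U w = x.

Lemma len0_le n m x : (n <= m)%nat -> len0 n x -> len0 m x.
Proof. intros H (w & H1 & H2 & H3). exists w. repeat split; [easy|lia|easy]. Qed.

Lemma len0_mul n m x y : len0 n x -> len0 m y -> len0 (n + m) (x ** y).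
Proof.
  intros (w & H1 & H2 & H3) (v & K1 & K2 & K3). exists (w ++ v). repeat split.
  - now apply Forall_app.
  - rewrite length_app. lia.
  - now rewrite ev_app, H3, K3.
Qed.

Lemma len0_inv n x : len0 n x -> len0 n x^-1.
Proof.
  intros (w & H1 & H2 & H3). exists (winv w). repeat split.
  - now apply winv_Forall.
  - now rewrite winv_length.
  - now rewrite ev_winv, H3.
Qed.

Lemma len0_one n : len0 n gone.
Proof. exists nil. repeat split; [constructor|simpl; lia]. Qed.

Lemma len0_comm n m x y : len0 n x -> len0 m y -> len0 (2 * n + 2 * m) [~ x, y].
Proof.
  intros Hx Hy. apply (len0_le (n + (m + (n + m)))); [lia|].
  unfold comm. auto using len0_mul, len0_inv.
Qed.

Lemma ev_repeat k t n : ev G U (repeat (false, (k, t)) n) = gpow G (U k t) n.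
Proof. induction n as [|n IH]; [easy|]. simpl repeat. rewrite ev_cons, IH. reflexivity. Qed.

Lemma ev_power_word k i z : ev G U (power_word k i z)
  = if (z <? 0)%Z then (gpow G (U k i) (Z.abs_nat z))^-1 else gpow G (U k i) (Z.abs_nat z).
Proof.
  unfold power_word. destruct (z <? 0)%Z; [|apply ev_repeat].
  rewrite <- ev_repeat, <- ev_winv. f_equal. unfold winv.
  now rewrite rev_repeat, map_repeat.
Qed.

End Length.

Lemma Rinv_range n : (1 <= n)%nat -> 0 <= / INR n <= 1.
Proof.
  intros Hn. apply le_INR in Hn. simpl in Hn. split.
  - left. apply Rinv_0_lt_compat. lra.
  - rewrite <- Rinv_1. apply Rinv_le_contravar; lra.
Qed.

Lemma pow_mul_inv n k : (1 <= n)%nat -> INR n ^ k * (/ INR n) ^ k = 1.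
Proof.
  intros Hn. apply le_INR in Hn. simpl in Hn.
  rewrite <- Rpow_mult_distr, Rinv_r, pow1; lra.
Qed.

Lemma nat_upper (x : R) : exists n : nat, (1 <= n)%nat /\ x <= INR n.
Proof.
  destruct (INR_unbounded x) as [n Hn]. exists (S n). rewrite S_INR. split; [lia|lra].
Qed.

(** * Comparison of word length with weight at scale n *)

Section Nilpotent.
Variable G : group.
Variable U : nat -> nat -> G.
Variables c d D : nat.
Hypothesis U_gamma : forall i t, gamma G i (U i t).
Hypothesis U_comm : forall i t s, exists b, [~ U i t, U 0 s] = U (S i) b.
Hypothesis U_dec : forall i t, U (S i) t = gone \/ exists b s, U (S i) t = [~ U i b, U 0 s].
Hypothesis U_gen : forall x, exists n, level_len G U 0 n x.
Hypothesis gamma_c : forall x, gamma G c x -> x = gone.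
Hypothesis U_trivial : forall i t, (d <= t)%nat -> U i t = gone.
Hypothesis U_bound : forall l m, exists w, level_ge (S (lev l + lev m)) w
  /\ (length w <= D)%nat /\ ev G U w = [~ lv G U l, lv G U m].

Let Wn n := wword G U (/ INR n).
Let Pn n := wexpo G U (/ INR n).
Let F := collect_factor D.

Lemma collect_factor_nonneg t : 0 <= t -> 0 <= F t.
Proof.
  intros Ht. unfold F, collect_factor. pose proof (pos_INR D) as HD.
  pose proof (exp_pos (INR D * t)).
  assert (0 <= INR D * t) by now apply Rmult_le_pos.
  apply Rmult_le_pos; [lra|]. assert (0 <= INR D * t * exp (INR D * t)) by nra. lra.
Qed.

Lemma collect_nat n k a t x : (1 <= n)%nat -> 0 <= t -> Pn n k a t x ->
  Wn n (S k) (t * F t) ((normal G U k d a)^-1 ** x).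
Proof. intros Hn. apply collect; [now apply Rinv_range|easy|easy]. Qed.

Lemma normal_truncate k a : normal G U k d (truncate d a) = normal G U k d a.
Proof.
  unfold normal. f_equal. apply normal_word_ext. intros i Hi.
  unfold truncate. now apply Nat.ltb_lt in Hi as ->.
Qed.

Lemma norm1_truncate a : norm1 d (truncate d a) = norm1 d a.
Proof. apply norm1_ext. intros i Hi. unfold truncate. now apply Nat.ltb_lt in Hi as ->. Qed.

Lemma wexpo_normal_truncate n k a :
  Pn n k (truncate d a) (IZR (norm1 d a) * (/ INR n) ^ S k) (normal G U k d a).
Proof.
  rewrite <- normal_truncate, <- norm1_truncate. apply wexpo_normal.
  intros i Hi. unfold truncate. now apply Nat.ltb_ge in Hi as ->.
Qed.

Lemma wword_gamma r k t x : wword G U r k t x -> gamma G k x.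
Proof. intros (w & H1 & _ & <-). now apply ev_gamma. Qed.

(** Collection at n = 1 with the weight forgotten: the exponent sums of level k determine the value
    modulo [gamma (k+1)]. *)
Lemma normal_cong k a b t x : (forall i, (i < d)%nat -> a i = b i) -> 0 <= t ->
  Pn 1 k a t x -> gamma G (S k) ((normal G U k d b)^-1 ** x).
Proof.
  intros Hab Ht Hx.
  apply (wword_gamma (/ INR 1) _ (t * F t)).
  replace (normal G U k d b) with (normal G U k d a).
  - apply collect_nat; [lia|easy|easy].
  - unfold normal. f_equal. now apply normal_word_ext.
Qed.

Lemma norm1_weight_nonneg n k a : (1 <= n)%nat -> 0 <= IZR (norm1 d a) * (/ INR n) ^ S k.
Proof.
  intros Hn. apply Rmult_le_pos; [apply IZR_le, norm1_nonneg|apply pow_le, Rinv_range, Hn].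
Qed.

(** Together with [normal_opp]: [normal] induces a homomorphism from Z^d to [gamma k] modulo
    [gamma (k+1)]. *)
Lemma normal_add k a b :
  gamma G (S k) ((normal G U k d (fun i => (a i + b i)%Z))^-1
    ** (normal G U k d a ** normal G U k d b)).
Proof.
  eapply normal_cong; [|..|apply wexpo_mul; apply wexpo_normal_truncate].
  - intros i Hi. simpl. unfold truncate. now apply Nat.ltb_lt in Hi as ->.
  - pose proof (norm1_weight_nonneg 1 k a). pose proof (norm1_weight_nonneg 1 k b).
    assert (1 <= 1)%nat by lia. auto using Rplus_le_le_0_compat.
Qed.

Lemma normal_opp k a :
  gamma G (S k) ((normal G U k d (fun i => (- a i)%Z))^-1 ** (normal G U k d a)^-1).
Proof.
  eapply normal_cong; [|..|apply wexpo_inv; apply wexpo_normal_truncate].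
  - intros i Hi. simpl. unfold truncate. now apply Nat.ltb_lt in Hi as ->.
  - apply norm1_weight_nonneg. lia.
Qed.

Lemma normal_ext k a b : (forall i, (i < d)%nat -> a i = b i) ->
  normal G U k d a = normal G U k d b.
Proof. intros H. unfold normal. f_equal. now apply normal_word_ext. Qed.

Definition nterm (k : nat) (p : bool * (nat -> Z)) : G :=
  if fst p then (normal G U k d (snd p))^-1 else normal G U k d (snd p).

Definition nprod (k : nat) (l : list (bool * (nat -> Z))) : G :=
  fold_right (fun p acc => nterm k p ** acc) gone l.

Lemma wexpo_nprod n k M l : (1 <= n)%nat ->
  Forall (fun p => IZR (norm1 d (snd p)) <= INR M) l ->
  exists a, (forall i, (i < d)%nat -> a i = vsum l i)
    /\ Pn n k a (INR (length l) * INR M * (/ INR n) ^ S k) (nprod k l).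
Proof.
  intros Hn. induction 1 as [|[b v] l Hp Hl (a & Ha & IH)].
  - exists (fun _ => 0%Z). split; [easy|]. simpl. apply wexpo_one. lra.
  - assert (Hv : exists a', (forall i, (i < d)%nat -> a' i = vterm (b, v) i)
      /\ Pn n k a' (INR M * (/ INR n) ^ S k) (nterm k (b, v))).
    { assert (Hv : Pn n k (truncate d v) (INR M * (/ INR n) ^ S k) (normal G U k d v)).
      { eapply wexpo_le; [|apply wexpo_normal_truncate]. apply Rmult_le_compat_r; [|easy].
        apply pow_le, Rinv_range, Hn. }
      destruct b.
      - exists (fun i => (- truncate d v i)%Z). split; [|now apply wexpo_inv].
        intros i Hi. unfold truncate, vterm. simpl. now apply Nat.ltb_lt in Hi as ->.
      - exists (truncate d v). split; [|easy].
        intros i Hi. unfold truncate, vterm. simpl. now apply Nat.ltb_lt in Hi as ->. }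
    destruct Hv as (a' & Ha' & Hv). exists (fun i => (a' i + a i)%Z). split.
    + intros i Hi. rewrite Ha, Ha' by easy. reflexivity.
    + simpl nprod. simpl length. rewrite S_INR.
      eapply wexpo_le; [|apply wexpo_mul; [apply Hv|apply IH]]. lra.
Qed.

(** At scale n, a word of n generators has weight 1, and collection moves its value into deeper and
    deeper letters. When x lies in [gamma (k+1)], the normal word collected at level k need not be
    empty: its exponent vector belongs to the lattice of those whose normal word lies in
    [gamma (k+1)], and this relation has to be rewritten in deeper letters. *)
Lemma len0_weight k : exists C, 0 <= C /\ forall n x, (1 <= n)%nat ->
  len0 G U n x -> gamma G k x -> Wn n k C x.
Proof.
  induction k as [|k (C & HC0 & HC)].
  - exists 1. split; [lra|]. intros n x Hn (w & H1 & H2 & H3) _.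
    exists w. repeat split; [now apply level_eq_ge| |easy].
    rewrite (wt_level_eq _ 0) by easy. apply le_INR in H2.
    pose proof (pow_mul_inv n 1 Hn) as H. pose proof (Rinv_range n Hn).
    rewrite !pow_1 in *. nra.
  - destruct (lattice_basis d (fun a => gamma G (S k) (normal G U k d a)))
      as (B & Cl & HB & HCl).
    { intros a b Hab Ha. now rewrite <- (normal_ext k a b Hab). }
    { intros a b Ha Hb. set (s := normal G U k d _).
      replace s with (normal G U k d a ** normal G U k d b
        ** (s^-1 ** (normal G U k d a ** normal G U k d b))^-1) by grp.
      apply (gamma_mul _ (S k)); [now apply (gamma_mul _ (S k))|].
      apply (gamma_inv _ (S k)), normal_add. }
    { intros a Ha. set (s := normal G U k d _).
      replace s with ((normal G U k d a)^-1 ** (s^-1 ** (normal G U k d a)^-1)^-1) by grp.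
      apply (gamma_mul _ (S k)); [now apply (gamma_inv _ (S k))|].
      apply (gamma_inv _ (S k)), normal_opp. }
    destruct (list_bound (fun b M => (norm1 d b <= Z.of_nat M)%Z) B) as [M HM].
    { intros; lia. }
    { intros b _. exists (Z.to_nat (norm1 d b)). pose proof (norm1_nonneg d b). lia. }
    (* Each generator of the relation lattice is rewritten once in letters of level above k; M'
       bounds the lengths of these finitely many words. *)
    destruct (list_bound (fun b M => exists w, level_ge (S k) w /\ (length w <= M)%nat
      /\ ev G U w = normal G U k d b) B) as [M' HM'].
    { intros b n m Hnm (w & ? & ? & ?). exists w. repeat split; [easy|lia|easy]. }
    { intros b Hb. rewrite Forall_forall in HB. specialize (HB b Hb).
      destruct (gamma_word G U U_gamma U_comm U_gen c gamma_c _ _ HB) as (w & H1 & H2).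
      exists (length w), w. repeat split; easy. }
    set (t := INR Cl * C * INR M). set (s := INR Cl * C * INR M').
    assert (Ht : 0 <= t) by (unfold t; auto using Rmult_le_pos, pos_INR).
    assert (Hs : 0 <= s) by (unfold s; auto using Rmult_le_pos, pos_INR).
    (* The weights of the three factors into which x is finally decomposed: the relation rewritten
       in deeper letters, its discrepancy from the normal word, and the remainder of the collection
       of x. *)
    exists (s + t * F t + C * F C). split.
    { pose proof (collect_factor_nonneg t Ht). pose proof (collect_factor_nonneg C HC0).
      assert (0 <= t * F t /\ 0 <= C * F C) by (split; now apply Rmult_le_pos). lra. }
    intros n x Hn Hlen Hx.
    destruct (HC n x Hn Hlen (gamma_S _ _ _ Hx)) as (w & H1 & H2 & H3).
    set (a := expo k w). pose proof (Rinv_range n Hn) as Hr.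
    assert (Ha : IZR (norm1 d a) * (/ INR n) ^ S k <= C)
      by (eapply Rle_trans; [now apply norm1_expo_le|easy]).
    set (r := (/ INR n) ^ S k) in Ha.
    assert (Hr0 : 0 <= r) by now apply pow_le.
    assert (Hy : Wn n (S k) (C * F C) ((normal G U k d a)^-1 ** x)).
    { apply collect_nat; [easy|easy|]. now exists w. }
    assert (Hna : gamma G (S k) (normal G U k d a)).
    { replace (normal G U k d a) with (x ** ((normal G U k d a)^-1 ** x)^-1) by grp.
      apply (gamma_mul _ (S k)); [easy|]. apply (gamma_inv _ (S k)).
      now apply wword_gamma in Hy. }
    destruct (HCl a Hna) as (l & L1 & L2 & L3).
    apply IZR_le in L2. rewrite mult_IZR, <- !INR_IZR_INZ in L2.
    assert (Hl : INR (length l) * r <= INR Cl * C).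
    { apply (Rle_trans _ (INR Cl * (IZR (norm1 d a) * r))).
      - rewrite <- Rmult_assoc. now apply Rmult_le_compat_r.
      - apply Rmult_le_compat_l; [apply pos_INR|easy]. }
    assert (Hb : exists a', (forall i, (i < d)%nat -> a' i = a i) /\ Pn n k a' t (nprod k l)).
    { destruct (wexpo_nprod n k M l Hn) as (a' & A1 & A2).
      - revert L1. apply Forall_impl. intros p Hp. rewrite INR_IZR_INZ. now apply IZR_le, HM.
      - exists a'. split; [intros i Hi; now rewrite A1, L3|].
        eapply wexpo_le; [|apply A2]. fold r. unfold t.
        pose proof (pos_INR M). nra. }
    destruct Hb as (a' & A1 & Hb).
    apply (collect_nat n k a' t) in Hb; [|easy|easy].
    rewrite (normal_ext k a' a A1) in Hb.
    assert (Hz : Wn n (S k) s (nprod k l)).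
    { assert (Hz : Wn n (S k) (INR (length l) * r * INR M') (nprod k l)).
      { clear L2 L3 Hl Hb. induction L1 as [|p l Hp Hl IH].
        - simpl. apply wword_one. lra.
        - simpl nprod. simpl length. rewrite S_INR.
          apply (wword_le _ _ _ _ (r * INR M' + INR (length l) * r * INR M')); [lra|].
          apply wword_mul; [|easy].
          destruct (HM' _ Hp) as (v & V1 & V2 & V3).
          assert (Hv : wword G U (/ INR n) (S k) (r * INR M') (normal G U k d (snd p))).
          { exists v. repeat split; [easy| |easy].
            apply (wt_le_length (/ INR n)) in V1; [|easy]. apply (Rle_trans _ _ _ V1).
            rewrite Rmult_comm. apply Rmult_le_compat; [now apply pow_le|apply pos_INR| |].
            - apply pow_le_pow_dec; [easy|lia].
            - now apply le_INR. }
          unfold nterm. destruct (fst p); [now apply wword_inv|easy]. }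
      revert Hz. apply wword_le. unfold s. apply Rmult_le_compat_r; [apply pos_INR|easy]. }
    replace x with (nprod k l ** ((normal G U k d a)^-1 ** nprod k l)^-1
      ** ((normal G U k d a)^-1 ** x)) by grp.
    apply wword_mul; [|easy]. apply wword_mul; [easy|now apply wword_inv].
Qed.

Definition single (t n : nat) (i : nat) : Z := if Nat.eqb i t then Z.of_nat n else 0%Z.

Lemma normal_single k t n : (t < d)%nat -> normal G U k d (single t n) = gpow G (U k t) n.
Proof.
  intros Ht. unfold normal.
  assert (H : forall e, ev G U (normal_word k e (single t n))
    = if Nat.ltb t e then gpow G (U k t) n else gone).
  { induction e as [|e IH]; [easy|]. simpl normal_word. rewrite ev_app, IH, ev_power_word.
    unfold single. destruct (Nat.ltb_spec t e), (Nat.ltb_spec t (S e)), (Nat.eqb_spec e t);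
      try lia; simpl; rewrite ?gmulx1, ?gmul1x; try easy.
    subst e. destruct (Z.ltb_spec (Z.of_nat n) 0); [lia|]. now rewrite Zabs2Nat.id. }
  rewrite H. now apply Nat.ltb_lt in Ht as ->.
Qed.

Lemma len0_gpow s n : len0 G U n (gpow G (U 0 s) n).
Proof.
  exists (repeat (false, (0, s))%nat n). repeat split.
  - apply Forall_forall. intros l Hl. apply repeat_spec in Hl. now subst l.
  - now rewrite repeat_length.
  - apply ev_repeat.
Qed.

Lemma wt_repeat r b k t n : wt r (repeat (b, (k, t)) n) = INR n * r ^ S k.
Proof.
  rewrite (wt_level_eq _ k).
  - now rewrite repeat_length.
  - apply Forall_forall. intros l Hl. apply repeat_spec in Hl. now subst l.
Qed.

Lemma wexpo_letter r k t : wexpo G U r k (single t 1) (r ^ S k) (U k t).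
Proof.
  exists ((false, (k, t)) :: nil). repeat split.
  - constructor; [apply Nat.le_refl|constructor].
  - change (r ^ S k + 0 <= r ^ S k). lra.
  - intros i. unfold expo, lexpo, lev, single. simpl. rewrite Nat.eqb_refl, Nat.eqb_sym.
    now destruct (Nat.eqb i t).
  - simpl. apply gmulx1.
Qed.

Lemma wexpo_conj_gpow n k a t x j s m : (1 <= n)%nat -> 0 <= t ->
  Pn n k a t x -> (INR m * (/ INR n) ^ S j <= 1) ->
  Pn n k a (t * exp (INR D)) (conjg x (gpow G (U j s) m)).
Proof.
  intros Hn Ht Hx Hm. rewrite <- ev_repeat.
  eapply wexpo_le; [|apply (wexpo_conj G U _ D (Rinv_range n Hn) U_bound), Hx].
  rewrite wt_repeat. apply Rmult_le_compat_l; [easy|]. apply exp_mono_le.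
  pose proof (pos_INR D). nra.
Qed.

(* This is how large powers of deep letters are written as short words: [[v^q, s^m]] is a
   [qm]-th power up to higher levels. *)
Lemma comm_powers k i s t C0 : 0 <= C0 -> [~ U k i, U 0 s] = U (S k) t ->
  exists C, 0 <= C /\ forall n q m y, (1 <= n)%nat ->
    INR q * (/ INR n) ^ S k <= 1 -> (m <= n)%nat -> Wn n (S k) C0 y ->
    Pn n (S k) (single t (q * m)) C [~ gpow G (U k i) q ** y, gpow G (U 0 s) m].
Proof.
  intros HC0 Ht. set (e := exp (INR D)).
  assert (He : 1 <= e).
  { unfold e. pose proof (exp_ineq1_le (INR D)). pose proof (pos_INR D). lra. }
  (* The summands belong to y^-1, to the commutator of the two powers, and to a conjugate of y. The
     factor e is the cost of conjugating by a power of weight at most 1. *)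
  exists (C0 + e * e + C0 * e). split; [nra|].
  intros n q m y Hn Hq Hm Hy.
  pose proof (Rinv_range n Hn) as Hr. set (r := / INR n) in *.
  set (v := U k i) in *. set (g := gpow G (U 0 s)).
  assert (Hrk : 0 <= r ^ S k) by now apply pow_le.
  assert (Hrk' : 0 <= r ^ S (S k)) by now apply pow_le.
  assert (Hr1 : forall m', (m' <= n)%nat -> INR m' * r ^ 1 <= 1).
  { intros m' Hm'. apply le_INR in Hm'. pose proof (pow_mul_inv n 1 Hn) as H.
    rewrite !pow_1 in *. fold r in H. nra. }
  assert (Hz : Pn n (S k) (single t m) (r ^ S k * e) (v^-1 ** conjg v (g m))).
  { assert (Hz : Pn n (S k) (single t m) (INR m * r ^ S (S k) * exp (INR D * (INR m * r)))
              (v^-1 ** conjg v (g m))).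
    { clear Hm. induction m as [|m IH].
      - replace (v^-1 ** conjg v (g 0%nat)) with (gone : G) by (unfold g; simpl; grp).
        eapply wexpo_ext; [|apply wexpo_one].
        + intros j. unfold single. now destruct (Nat.eqb j t).
        + simpl. lra.
      - assert (Eg : g (S m) = g m ** U 0 s).
        { unfold g. clear. simpl. induction m as [|m IH]; simpl; [now rewrite gmul1x, gmulx1|].
          now rewrite IH at 1; rewrite gmulA. }
        replace (v^-1 ** conjg v (g (S m)))
          with ([~ v, U 0 s] ** conjg (v^-1 ** conjg v (g m)) (ev G U ((false, (0, s))%nat :: nil)))
          by (rewrite Eg; simpl; unfold lv; simpl; grp).
        rewrite Ht.
        eapply wexpo_ext; [|eapply wexpo_le; [|apply wexpo_mul; [apply wexpo_letter
          |apply (wexpo_conj G U _ D Hr U_bound), IH]]].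
        + intros j. unfold single. destruct (Nat.eqb j t); lia.
        + simpl wt. rewrite S_INR, Rplus_0_r, Rmult_1_r.
          replace (INR D * ((INR m + 1) * r)) with (INR D * (INR m * r) + INR D * r) by ring.
          rewrite exp_plus. fold r.
          pose proof (pos_INR m). pose proof (pos_INR D).
          assert (0 <= INR D * (INR m * r)) by (repeat apply Rmult_le_pos; easy || apply Hr).
          assert (0 <= INR D * r) by (repeat apply Rmult_le_pos; easy || apply Hr).
          pose proof (exp_ineq1_le (INR D * (INR m * r))).
          pose proof (exp_ineq1_le (INR D * r)).
          assert (1 <= exp (INR D * (INR m * r)) * exp (INR D * r)) by nra.
          nra. }
    eapply wexpo_le; [|apply Hz].
    specialize (Hr1 m Hm). rewrite pow_1 in Hr1.
    assert (exp (INR D * (INR m * r)) <= e).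
    { apply exp_mono_le. pose proof (pos_INR D). nra. }
    replace (INR m * r ^ S (S k)) with (r ^ S k * (INR m * r)) by (simpl; ring).
    pose proof (exp_pos (INR D * (INR m * r))). pose proof (pos_INR m).
    assert (0 <= INR m * r) by (apply Rmult_le_pos; easy || apply Hr).
    apply Rmult_le_compat; nra. }
  set (z := v^-1 ** conjg v (g m)) in Hz.
  (* The commutator of v^q with the power [g m] is a product of q conjugates of z, each with
     exponent m at t. *)
  assert (Hzq : Pn n (S k) (single t (q * m)) (INR q * (r ^ S k * e * e))
    ((gpow G v q)^-1 ** conjg (gpow G v q) (g m))).
  { revert Hq. induction q as [|q IH]; intros Hq.
    - replace ((gpow G v 0)^-1 ** conjg (gpow G v 0) (g m)) with (gone : G) by (simpl; grp).
      eapply wexpo_ext; [|apply wexpo_one].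
      + intros j. unfold single. now destruct (Nat.eqb j t).
      + simpl. lra.
    - rewrite S_INR in Hq.
      replace ((gpow G v (S q))^-1 ** conjg (gpow G v (S q)) (g m))
        with (conjg z (gpow G v q) ** ((gpow G v q)^-1 ** conjg (gpow G v q) (g m)))
        by (unfold z; simpl; grp).
      eapply wexpo_ext; [|eapply wexpo_le; [|apply wexpo_mul; [apply wexpo_conj_gpow; [easy| |apply Hz|]
        |apply IH; lra]]].
      + intros j. unfold single. destruct (Nat.eqb j t); lia.
      + rewrite S_INR. fold e. lra.
      + apply Rmult_le_pos; lra.
      + fold r. lra. }
  (* The factors y^-1 and the conjugate of y have opposite exponent sums, so the unknown error y
     does not disturb the exponent qm. *)
  replace [~ gpow G v q ** y, g m]
    with (y^-1 ** ((gpow G v q)^-1 ** conjg (gpow G v q) (g m)) ** conjg y (g m)) by grp.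
  destruct Hy as (w & H1 & H2 & H3).
  assert (Hy : Pn n (S k) (expo (S k) w) C0 y) by now exists w.
  eapply wexpo_ext; [|eapply wexpo_le; [|apply wexpo_mul; [apply wexpo_mul; [apply wexpo_inv, Hy|apply Hzq]
    |exact (wexpo_conj_gpow n (S k) _ C0 y 0 s m Hn HC0 Hy (Hr1 m Hm))]]].
  - intros j. simpl. lia.
  - fold e. pose proof (pos_INR q). nra.
Qed.

(** A letter of level k+1 is a commutator [u, s] with u of level k. Writing a = qn + m, and taking
    short elements x1, x2 that represent u^q, u^m up to deeper errors, the product [x1, s^n] [x2, s]
    is short and has exponent qn + m at that letter. Collecting it leaves an error of bounded weight
    one level deeper. *)
Lemma letter_power k : exists C, forall n t a, (1 <= n)%nat -> (a <= n ^ S k)%nat ->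
  exists x y, len0 G U (C * n) x /\ Wn n (S k) (INR C) y /\ x = gpow G (U k t) a ** y.
Proof.
  assert (Hpow : forall n k', (1 <= n)%nat -> 0 <= (/ INR n) ^ k').
  { intros n k' Hn. now apply pow_le, Rinv_range. }
  assert (Hone : forall a, gpow G gone a = gone).
  { induction a as [|a IH]; simpl; [easy|]. now rewrite IH, gmul1x. }
  induction k as [|k (C & HC)].
  - exists 1%nat. intros n t a Hn Ha. exists (gpow G (U 0 t) a), gone. repeat split.
    + apply (len0_le _ _ a); [simpl in Ha; lia|apply len0_gpow].
    + apply wword_one. simpl. lra.
    + now rewrite gmulx1.
  - assert (Hs : forall t, exists C', forall n a, (1 <= n)%nat -> (a <= n ^ S (S k))%nat ->
      exists x y, len0 G U (C' * n) x /\ Wn n (S (S k)) (INR C') y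
        /\ x = gpow G (U (S k) t) a ** y).
    { intros t. destruct (U_dec k t) as [Et|(i & s & Et)].
      { exists 0%nat. intros n a Hn Ha. exists gone, gone. repeat split.
        - apply len0_one.
        - apply wword_one. simpl. lra.
        - rewrite Et, Hone. now rewrite gmul1x. }
      destruct (Nat.lt_ge_cases t d) as [Htd|Htd].
      2:{ exists 0%nat. intros n a Hn Ha. exists gone, gone. repeat split.
        - apply len0_one.
        - apply wword_one. simpl. lra.
        - rewrite U_trivial by easy. now rewrite Hone, gmul1x. }
      destruct (comm_powers k i s t (INR C) (pos_INR C) (eq_sym Et)) as (C1 & HC1 & H1).
      destruct (nat_upper ((C1 + C1) * F (C1 + C1))) as (C2 & _ & HC2).
      (* 4C + 4 counts the letters of the two commutators in units of n; C2 bounds the weight left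
         by collecting them. *)
      exists (4 * C + 4 + C2)%nat. intros n a Hn Ha.
      set (q := (a / n)%nat). set (m := (a mod n)%nat).
      assert (Ea : a = (q * n + m)%nat).
      { unfold q, m. rewrite Nat.mul_comm. apply Nat.div_mod. lia. }
      assert (Hm : (m < n)%nat) by (apply Nat.mod_upper_bound; lia).
      assert (Hq : (q <= n ^ S k)%nat).
      { unfold q. apply Nat.Div0.div_le_upper_bound. simpl in Ha |- *. lia. }
      assert (Hm' : (m <= n ^ S k)%nat).
      { simpl. assert (1 <= n ^ k)%nat by (apply Nat.neq_0_lt_0, Nat.pow_nonzero; lia). nia. }
      assert (Hw : forall p, (p <= n ^ S k)%nat -> INR p * (/ INR n) ^ S k <= 1).
      { intros p Hp. rewrite <- (pow_mul_inv n (S k) Hn). rewrite <- pow_INR.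
        apply Rmult_le_compat_r; [now apply Hpow|now apply le_INR]. }
      destruct (HC n i q Hn Hq) as (x1 & y1 & X1 & Y1 & E1).
      destruct (HC n i m Hn Hm') as (x2 & y2 & X2 & Y2 & E2).
      pose proof (H1 n q n y1 Hn (Hw q Hq) (Nat.le_refl n) Y1) as P1.
      pose proof (H1 n m 1%nat y2 Hn (Hw m Hm') Hn Y2) as P2.
      rewrite <- E1 in P1. rewrite <- E2 in P2.
      set (x := [~ x1, gpow G (U 0 s) n] ** [~ x2, gpow G (U 0 s) 1]).
      exists x, ((gpow G (U (S k) t) a)^-1 ** x). repeat split.
      - apply (len0_le _ _ ((2 * (C * n) + 2 * n) + (2 * (C * n) + 2 * 1))); [nia|].
        apply len0_mul; apply len0_comm; auto using len0_gpow.
      - rewrite <- normal_single by easy. eapply wword_le; [|apply collect_nat].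
        + apply (Rle_trans _ _ _ HC2). apply le_INR. lia.
        + easy.
        + lra.
        + eapply wexpo_ext; [|apply wexpo_mul; [apply P1|apply P2]].
          intros j. unfold single. destruct (Nat.eqb j t); lia.
      - grp. }
    destruct (uniform_bound d (fun t C' => forall n a, (1 <= n)%nat -> (a <= n ^ S (S k))%nat ->
      exists x y, len0 G U (C' * n) x /\ Wn n (S (S k)) (INR C') y
        /\ x = gpow G (U (S k) t) a ** y)) as (C' & HC').
    + intros t p p' Hp H n a Hn Ha. destruct (H n a Hn Ha) as (x & y & X & Y & E).
      exists x, y. repeat split; [|eapply wword_le, Y; now apply le_INR|easy].
      revert X. apply len0_le. nia.
    + easy.
    + intros t Ht n a Hn Ha. exists gone, gone. repeat split.
      * apply len0_one.
      * apply wword_one. simpl. lra.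
      * rewrite U_trivial by easy. now rewrite Hone, gmul1x.
    + exists C'. intros n t a. apply HC'.
Qed.

(** Descending induction from the class. The part collected at level k is a product of d powers;
    each of them is a short element up to an error of level at least k+1, and these errors, like the
    remainder of the collection, are short by induction. *)
Lemma weight_len0 k t : 0 <= t -> exists C, forall n x, (1 <= n)%nat ->
  Wn n k t x -> len0 G U (C * n) x.
Proof.
  intros Ht0.
  assert (Hbase : forall k' s n x, (c <= k')%nat -> Wn n k' s x -> x = gone).
  { intros k' s n x Hk Hx. apply gamma_c. apply (gamma_le _ _ k'); [easy|].
    now apply (wword_gamma (/ INR n) _ s). }
  destruct (Nat.le_ge_cases c k) as [Hck|Hck].
  { exists 0%nat. intros n x _ Hx. rewrite (Hbase _ _ _ _ Hck Hx). apply len0_one. }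
  remember (c - k)%nat as j eqn:Ej. revert k t Ht0 Hck Ej.
  induction j as [|j IH]; intros k t Ht0 Hck Ej.
  { exists 0%nat. intros n x _ Hx. assert (H : (c <= k)%nat) by lia.
    rewrite (Hbase _ _ _ _ H Hx). apply len0_one. }
  assert (IHk : forall t, 0 <= t -> exists C, forall n x, (1 <= n)%nat ->
    Wn n (S k) t x -> len0 G U (C * n) x).
  { intros s Hs. apply IH; [easy|lia|lia]. }
  clear IH. destruct (letter_power k) as (C1 & HC1).
  destruct (IHk (INR C1) (pos_INR C1)) as (C2 & HC2).
  assert (Hpow : forall n i a, (1 <= n)%nat -> (a <= n ^ S k)%nat ->
    len0 G U ((C1 + C2) * n) (gpow G (U k i) a)).
  { intros n i a Hn Ha. destruct (HC1 n i a Hn Ha) as (x & y & X & Y & E).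
    replace (gpow G (U k i) a) with (x ** y^-1) by (rewrite E; grp).
    rewrite Nat.mul_add_distr_r. apply len0_mul; [easy|]. now apply len0_inv, HC2. }
  assert (Hnorm : forall e n a, (1 <= n)%nat -> (forall i, (i < e)%nat -> (Z.abs (a i) <= Z.of_nat (n ^ S k))%Z) ->
    len0 G U (e * ((C1 + C2) * n)) (normal G U k e a)).
  { intros e n a Hn. unfold normal. induction e as [|e IHe]; intros Ha; [apply len0_one|].
    simpl normal_word. rewrite ev_app.
    apply (len0_le _ _ (e * ((C1 + C2) * n) + (C1 + C2) * n)); [lia|].
    apply len0_mul; [apply IHe; intros; apply Ha; lia|].
    specialize (Ha e ltac:(lia)). rewrite ev_power_word.
    destruct (a e <? 0)%Z; [apply len0_inv|]; apply Hpow; lia. }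
  assert (HtF : 0 <= t * F t) by (apply Rmult_le_pos; [easy|now apply collect_factor_nonneg]).
  destruct (IHk (t * F t) HtF) as (C3 & HC3).
  (* The exponents reach t n^(k+1), whereas powers are controlled up to n^(k+1) at scale n. As t <=
     m <= m^(k+1), the scale mn accommodates them. *)
  destruct (nat_upper t) as (m & Hm & Htm).
  exists (d * ((C1 + C2) * m) + C3)%nat. intros n x Hn (w & H1 & H2 & H3).
  set (a := expo k w).
  assert (Hy : Wn n (S k) (t * F t) ((normal G U k d a)^-1 ** x)).
  { apply collect_nat; [easy|easy|]. now exists w. }
  replace x with (normal G U k d a ** ((normal G U k d a)^-1 ** x)) by grp.
  rewrite Nat.mul_add_distr_r. apply len0_mul; [|now apply HC3].
  apply (len0_le _ _ (d * ((C1 + C2) * (m * n)))); [nia|].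
  apply Hnorm; [nia|]. intros i Hi.
  assert (Hai : (Z.abs (a i) <= norm1 d a)%Z).
  { clear -Hi. revert Hi. generalize a. intros b. induction d as [|e IHe]; [lia|].
    intros Hi. simpl. pose proof (norm1_nonneg e b).
    destruct (Nat.eq_dec i e) as [->|]; [lia|]. specialize (IHe ltac:(lia)). lia. }
  pose proof (norm1_expo_le (/ INR n) k d w (proj1 (Rinv_range n Hn))) as Hna. fold a in Hna.
  assert (Hb : IZR (norm1 d a) <= t * INR n ^ S k).
  { pose proof (pow_mul_inv n (S k) Hn) as Hinv.
    assert (0 <= INR n ^ S k) by apply pow_le, pos_INR.
    replace (IZR (norm1 d a)) with (IZR (norm1 d a) * (/ INR n) ^ S k * INR n ^ S k).
    - apply Rmult_le_compat_r; [easy|]. lra.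
    - rewrite Rmult_assoc, (Rmult_comm ((/ INR n) ^ S k)), Hinv. ring. }
  apply le_IZR. rewrite <- INR_IZR_INZ, pow_INR, mult_INR, Rpow_mult_distr.
  apply IZR_le in Hai. apply (Rle_trans _ _ _ Hai), (Rle_trans _ _ _ Hb).
  apply Rmult_le_compat_r; [apply pow_le, pos_INR|]. apply (Rle_trans _ _ _ Htm).
  rewrite <- (pow_1 (INR m)) at 1. apply Rle_pow; [|lia].
  apply le_INR in Hm. simpl in Hm. lra.
Qed.

Hypothesis U_len : forall x, exists n, len0 G U n x.

(* Measured with weights for [n = delta ((C0 + 1) A)^k], [delta] large, the weight of
   [psi^k x] is nonincreasing in [k]. *)
Lemma substitution_growth (V : nat -> nat -> G) (e C0 : nat) (psi : G -> G) (A : nat) :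
  (forall i t, gamma G i (V i t)) ->
  (forall i t, (c <= i \/ e <= t)%nat -> V i t = gone) ->
  is_hom G psi -> (1 <= A)%nat ->
  (forall i t, exists w1 w2, level_eq i w1 /\ (length w1 <= C0 * A ^ S i)%nat
     /\ level_ge (S i) w2 /\ psi (V i t) = ev G V w1 ** ev G V w2) ->
  forall w, exists E, forall k,
    len0 G U (E * ((C0 + 1) * A) ^ k) (Nat.iter k psi (ev G V w)).
Proof.
  intros Vg Vt Hpsi HA Hsub w.
  destruct (uniform_bound2 c e (fun i t n => exists w1 w2, level_eq i w1
     /\ (length w1 <= C0 * A ^ S i)%nat /\ level_ge (S i) w2 /\ (length w2 <= n)%nat
     /\ psi (V i t) = ev G V w1 ** ev G V w2)) as (D2 & HD2).
  { intros i t n m Hnm (w1 & w2 & H1 & H2 & H3 & H4 & H5).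
    exists w1, w2. repeat split; try easy. lia. }
  { intros i t. destruct (Hsub i t) as (w1 & w2 & H1 & H2 & H3 & H4).
    exists (length w2), w1, w2. now repeat split. }
  { intros i t Hit. exists nil, nil. repeat split; try constructor; try (simpl; lia).
    rewrite Vt by easy. rewrite hom_one by easy. simpl. now rewrite gmul1x. }
  (* The action of psi is described in the alphabet V, length is measured in U. M bounds the
     translation of a letter of V, which does not lower its level. *)
  destruct (uniform_bound2 c e (fun i t n => exists v, level_ge i v /\ (length v <= n)%nat
     /\ ev G U v = V i t)) as (M & HM).
  { intros i t n m Hnm (v & H1 & H2 & H3). exists v. repeat split; [easy|lia|easy]. }
  { intros i t. destruct (gamma_word G U U_gamma U_comm U_gen c gamma_c _ _ (Vg i t))
      as (v & H1 & H2). exists (length v), v. now repeat split. }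
  { intros i t Hit. exists nil. repeat split; [constructor|easy|]. now rewrite Vt. }
  set (B := ((C0 + 1) * A)%nat). set (delta := (D2 + 1)%nat).
  assert (HB : (1 <= B)%nat) by (unfold B; nia).
  (* Here C0 A^(i+1) + 1 <= B^(i+1). At scale nB the letters of level i in the image of a letter are
     paid by the first summand; the deeper ones, at most D2, together weigh no more than one letter
     of level i because nB >= D2, and are paid by the 1. Thus D2 affects the initial scale [delta]
     and not the growth factor B. *)
  assert (Hstep : forall n v, (delta <= n)%nat -> exists v',
    wt (/ INR (n * B)) v' <= wt (/ INR n) v /\ ev G V v' = psi (ev G V v)).
  { intros n v Hn. assert (Hn1 : (1 <= n)%nat) by (unfold delta in Hn; lia).
    assert (HnB : (1 <= n * B)%nat) by nia.
    pose proof (Rinv_range _ HnB) as Hr'. pose proof (Rinv_range _ Hn1) as Hr.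
    set (r' := / INR (n * B)) in *. set (r := / INR n) in *.
    assert (Err' : r' * INR B = r).
    { unfold r', r. rewrite mult_INR. apply le_INR in HB, Hn1. simpl in HB, Hn1. field. lra. }
    induction v as [|[b [i t]] v (v' & V1 & V2)].
    { exists nil. split; [simpl; lra|]. simpl. now rewrite hom_one. }
    assert (Hlet : exists u, wt r' u <= r ^ S i /\ ev G V u = psi (V i t)).
    { destruct (HD2 i t) as (w1 & w2 & H1 & H2 & H3 & H4 & H5).
      exists (w1 ++ w2). rewrite wt_app, ev_app. split; [|easy].
      rewrite (wt_level_eq _ i) by easy.
      apply (wt_le_length r') in H3; [|easy].
      apply le_INR in H2, H4. rewrite mult_INR, pow_INR in H2.
      assert (Hp : 0 <= r' ^ S i) by now apply pow_le.
      rewrite <- Err', Rpow_mult_distr.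
      assert (HD : INR D2 * r' <= 1).
      { unfold r'. assert (HDn : (D2 <= n * B)%nat) by (unfold delta in Hn; nia).
        apply le_INR in HDn. apply le_INR in HnB. simpl in HnB.
        apply (Rmult_le_reg_r (INR (n * B))); [lra|].
        rewrite Rmult_assoc, Rinv_l; lra. }
      assert (HBi : INR C0 * INR A ^ S i + 1 <= INR B ^ S i).
      { unfold B. rewrite mult_INR, Rpow_mult_distr, plus_INR. simpl (INR 1).
        pose proof (pos_INR C0). apply le_INR in HA. simpl in HA.
        assert (INR C0 + 1 <= (INR C0 + 1) ^ S i).
        { rewrite <- (pow_1 (INR C0 + 1)) at 1. apply Rle_pow; [lra|lia]. }
        assert (1 <= INR A ^ S i) by now apply pow_R1_Rle.
        nra. }
      change (r' ^ S (S i)) with (r' * r' ^ S i) in H3.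
      assert (INR (length w2) * (r' * r' ^ S i) <= r' ^ S i).
      { assert (INR (length w2) * r' <= 1) by nra. nra. }
      assert (INR (length w1) * r' ^ S i <= INR C0 * INR A ^ S i * r' ^ S i)
        by (now apply Rmult_le_compat_r).
      nra. }
    destruct Hlet as (u & U1 & U2).
    assert (Hb : exists u', wt r' u' <= r ^ S i /\ ev G V u' = psi (lv G V (b, (i, t)))).
    { unfold lv. simpl. destruct b; [|now exists u].
      exists (winv u). rewrite wt_winv, ev_winv, U2. split; [easy|]. now rewrite hom_inv. }
    destruct Hb as (u' & U3 & U4). exists (u' ++ v').
    rewrite wt_app, ev_app, ev_cons, Hpsi, U4, V2. split; [|easy].
    change (wt r' u' + wt r' v' <= r ^ S i + wt r v). lra. }
  assert (Hiter : forall k, exists v, wt (/ INR (delta * B ^ k)) v <= wt (/ INR delta) w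
    /\ ev G V v = Nat.iter k psi (ev G V w)).
  { induction k as [|k (v & H1 & H2)].
    - exists w. simpl. rewrite Nat.mul_1_r. split; [lra|easy].
    - destruct (Hstep (delta * B ^ k)%nat v) as (v' & H3 & H4).
      + assert (1 <= B ^ k)%nat by (apply Nat.neq_0_lt_0, Nat.pow_nonzero; lia). nia.
      + exists v'. replace (delta * B ^ S k)%nat with (delta * B ^ k * B)%nat by (simpl; lia).
        split; [lra|]. simpl. now rewrite H4, H2. }
  set (t0 := wt (/ INR delta) w * INR M).
  assert (Hdelta : (1 <= delta)%nat) by (unfold delta; lia).
  assert (Ht0 : 0 <= t0).
  { apply Rmult_le_pos; [|apply pos_INR]. apply wt_nonneg, Rinv_range, Hdelta. }
  destruct (weight_len0 0 t0 Ht0) as (C & HC).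
  exists (C * delta)%nat. intros k. fold B. rewrite <- Nat.mul_assoc.
  assert (Hn : (1 <= delta * B ^ k)%nat).
  { assert (1 <= B ^ k)%nat by (apply Nat.neq_0_lt_0, Nat.pow_nonzero; lia). nia. }
  apply HC; [easy|]. destruct (Hiter k) as (v & H1 & <-).
  pose proof (Rinv_range _ Hn) as Hr.
  apply (wword_le _ _ _ _ (wt (/ INR (delta * B ^ k)) v * INR M));
    [apply Rmult_le_compat_r; [apply pos_INR|easy]|].
  clear H1. set (r := / INR (delta * B ^ k)) in *.
  induction v as [|[b [i t]] v IH]; [apply wword_one; simpl; lra|].
  rewrite ev_cons. change (wt r ((b, (i, t)) :: v)) with (r ^ S i + wt r v).
  rewrite Rmult_plus_distr_r. apply wword_mul; [|easy].
  destruct (HM i t) as (u & U1 & U2 & U3).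
  assert (Hu : wword G U r 0 (r ^ S i * INR M) (V i t)).
  { exists u. repeat split; [|..|easy].
    - revert U1. apply level_ge_le. lia.
    - apply (wt_le_length r) in U1; [|easy]. apply le_INR in U2.
      pose proof (pow_le r (S i) (proj1 Hr)). nra. }
  unfold lv. simpl. destruct b; [now apply wword_inv|easy].
Qed.

(** Letters above level k vanish modulo [gamma (k+1)], and weight t has room for t n^(k+1) letters
    of level k. *)
Lemma level_len_weight n k t x : (1 <= n)%nat -> Wn n k t x ->
  forall m, t <= INR m -> level_len G U k (m * n ^ S k) x.
Proof.
  intros Hn (w & H1 & H2 & <-) m Hm.
  assert (Hw : exists p, level_len G U k p (ev G U w) /\ INR p * (/ INR n) ^ S k <= wt (/ INR n) w).
  { clear H2. pose proof (Rinv_range n Hn) as Hr.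
    induction H1 as [|l w Hl Hw (p & P1 & P2)].
    - exists 0%nat. split; [apply level_len_one|simpl; lra].
    - rewrite ev_cons.
      change (wt (/ INR n) (l :: w)) with ((/ INR n) ^ S (lev l) + wt (/ INR n) w).
      destruct (Nat.eq_dec (lev l) k) as [<-|Hne].
      + exists (S p). rewrite S_INR. split; [|lra].
        apply (level_len_mul G U _ 1); [apply level_len_letter|easy].
      + exists p. pose proof (pow_le (/ INR n) (S (lev l)) (proj1 Hr)). split; [|lra].
        apply (level_len_mul G U _ 0); [|easy]. apply level_len_gamma.
        apply (gamma_le _ _ (lev l)); [lia|]. now apply lv_gamma. }
  destruct Hw as (p & P1 & P2). apply (level_len_le _ _ _ p); [|easy].
  apply INR_le. rewrite mult_INR, pow_INR.
  pose proof (pow_mul_inv n (S k) Hn) as Hinv.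
  assert (0 <= INR n ^ S k) by apply pow_le, pos_INR.
  replace (INR p) with (INR p * (/ INR n) ^ S k * INR n ^ S k).
  - apply Rmult_le_compat_r; [easy|]. lra.
  - rewrite Rmult_assoc, (Rmult_comm ((/ INR n) ^ S k)), Hinv. ring.
Qed.

Lemma len0_level_len k : exists C, forall n x, (1 <= n)%nat ->
  len0 G U n x -> gamma G k x -> level_len G U k (C * n ^ S k) x.
Proof.
  destruct (len0_weight k) as (C & _ & HC). destruct (nat_upper C) as (m & _ & Hm).
  exists m. intros n x Hn H1 H2. now apply (level_len_weight n k C); [|apply HC|].
Qed.

(* By multilinearity of iterated commutators, the growth on all the levels is controlled by
   the growth on the abelianization. *)
Lemma abelian_growth psi A : is_hom G psi -> (1 <= A)%nat ->
  (forall t, level_len G U 0 A (psi (U 0 t))) ->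
  forall x, exists E, forall k, len0 G U (E * (2 * A) ^ k) (Nat.iter k psi x).
Proof.
  intros Hpsi HA HT x.
  destruct (U_len x) as (n & w & _ & _ & <-).
  (* Since [level_len_comm] has no constant, C0 = 1 suffices at all levels; this is the origin of
     the base 2A. *)
  apply (substitution_growth U d 1 psi A); try easy.
  - intros i t [Hi|Ht]; [|now apply U_trivial].
    now apply gamma_c, (gamma_le _ _ i).
  - assert (HTi : forall i t, level_len G U i (A ^ S i) (psi (U i t))).
    { induction i as [|i IH]; intros t; [now rewrite Nat.pow_1_r|].
      destruct (U_dec i t) as [->|(b & s & ->)].
      - rewrite hom_one by easy. apply level_len_one.
      - rewrite hom_comm by easy.
        replace (A ^ S (S i))%nat with (A ^ S i * A)%nat by (simpl; lia).
        now apply level_len_comm. }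
    intros i t. destruct (HTi i t) as (w1 & H1 & H2 & H3).
    destruct (gamma_word G U U_gamma U_comm U_gen c gamma_c _ _ H3) as (w2 & H4 & H5).
    exists w1, w2. repeat split; [easy|lia|easy|]. rewrite H5. grp.
Qed.

Lemma len0_lipschitz f : is_hom G f -> exists C, forall n x, len0 G U n x -> len0 G U (C * n) (f x).
Proof.
  intros Hf.
  destruct (uniform_bound d (fun t n => len0 G U n (f (U 0 t)))) as (C & HC).
  - intros t n m Hnm. now apply len0_le.
  - intros t. apply U_len.
  - intros t Ht. rewrite U_trivial, hom_one by easy. apply len0_one.
  - exists C. intros n x (w & H1 & H2 & <-). apply (len0_le _ _ (C * length w)); [nia|].
    clear H2. induction H1 as [|[b [i t]] w Hl Hw IH].
    + simpl. rewrite hom_one by easy. apply len0_one.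
    + unfold lev in Hl. simpl in Hl. subst i. rewrite ev_cons, Hf. simpl length.
      rewrite Nat.mul_succ_r, Nat.add_comm. apply len0_mul; [|easy].
      unfold lv. simpl. destruct b; [|easy]. rewrite hom_inv by easy. now apply len0_inv.
Qed.

(** * Growth along the orbit of one element *)

Section Orbit.
Variable phi : G -> G.
Hypothesis phi_hom : is_hom G phi.
Variable g : G.

(** The level index is a dummy: [ev] is reused for words in the forward orbit, whose values form the
    subgroup H. *)
Let O (i j : nat) : G := Nat.iter j phi g.
Let H (x : G) : Prop := exists w, ev G O w = x.

Lemma orbit_mul x y : H x -> H y -> H (x ** y).
Proof. intros [w <-] [v <-]. exists (w ++ v). apply ev_app. Qed.

Lemma orbit_inv x : H x -> H x^-1.
Proof. intros [w <-]. exists (winv w). apply ev_winv. Qed.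

Lemma orbit_one : H gone.
Proof. now exists nil. Qed.

Lemma orbit_ev V w : (forall i t, H (V i t)) -> H (ev G V w).
Proof.
  intros HV. induction w as [|[b [i t]] w IH]; [apply orbit_one|].
  rewrite ev_cons. apply orbit_mul; [|easy].
  unfold lv. simpl. destruct b; [apply orbit_inv|]; apply HV.
Qed.

Lemma iter_comm (f : G -> G) n m x : Nat.iter n f (Nat.iter m f x) = Nat.iter m f (Nat.iter n f x).
Proof. now rewrite <- !Nat.iter_add, Nat.add_comm. Qed.

Lemma orbit_iter m x : H x -> H (Nat.iter m phi x).
Proof.
  intros [w <-]. induction w as [|[b [i j]] w IH].
  - simpl. rewrite hom_one by now apply hom_iter. apply orbit_one.
  - rewrite ev_cons, (hom_iter _ phi m phi_hom). apply orbit_mul; [|easy].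
    assert (Hj : H (Nat.iter m phi (O i j))).
    { exists ((false, (i, (m + j)%nat)) :: nil). simpl. rewrite gmulx1.
      unfold lv, O. simpl. now rewrite Nat.iter_add. }
    unfold lv. simpl. destruct b; [|easy].
    rewrite (hom_inv _ _ _ (hom_iter _ phi m phi_hom)). now apply orbit_inv.
Qed.

(** K does not depend on m, because phi^m phi^j g = phi^j phi^m g and phi^j multiplies lengths by at
    most C^j. *)
Lemma orbit_len x : H x -> exists K, forall m n,
  len0 G U n (Nat.iter m phi g) -> len0 G U (K * n) (Nat.iter m phi x).
Proof.
  destruct (len0_lipschitz phi phi_hom) as (C & HC).
  assert (Hj : forall j m n, len0 G U n (Nat.iter m phi g) ->
    len0 G U (C ^ j * n) (Nat.iter m phi (Nat.iter j phi g))).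
  { intros j m n Hn. rewrite iter_comm. induction j as [|j IH].
    - simpl. now rewrite Nat.add_0_r.
    - simpl. rewrite <- Nat.mul_assoc. now apply HC. }
  intros [w <-]. induction w as [|[b [i j]] w (K & HK)].
  - exists 0%nat. intros m n _. simpl. rewrite (hom_one _ _ (hom_iter _ phi m phi_hom)).
    apply len0_one.
  - exists (C ^ j + K)%nat. intros m n Hn. rewrite ev_cons, (hom_iter _ phi m phi_hom).
    rewrite Nat.mul_add_distr_r. apply len0_mul; [|now apply HK].
    unfold lv. simpl. destruct b; [|now apply Hj].
    rewrite (hom_inv _ _ _ (hom_iter _ phi m phi_hom)). now apply len0_inv, Hj.
Qed.

Definition gcong (k : nat) (x y : G) : Prop := gamma G (S k) (x^-1 ** y).

Lemma gcong_refl k x : gcong k x x.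
Proof. unfold gcong. rewrite gmulVx. apply (gamma_one _ (S k)). Qed.

Lemma gcong_sym k x y : gcong k x y -> gcong k y x.
Proof.
  unfold gcong. intros Hxy. replace (y^-1 ** x) with (x^-1 ** y)^-1 by grp.
  now apply (gamma_inv _ (S k)).
Qed.

Lemma gcong_trans k x y z : gcong k x y -> gcong k y z -> gcong k x z.
Proof.
  unfold gcong. intros Hxy Hyz. replace (x^-1 ** z) with (x^-1 ** y ** (y^-1 ** z)) by grp.
  now apply (gamma_mul _ (S k)).
Qed.

Lemma gcong_mul k x y x' y' : gcong k x x' -> gcong k y y' -> gcong k (x ** y) (x' ** y').
Proof.
  unfold gcong. intros Hx Hy.
  replace ((x ** y)^-1 ** (x' ** y')) with (conjg (x^-1 ** x') y ** (y^-1 ** y')) by grp.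
  apply (gamma_mul _ (S k)); [now apply (gamma_conj _ (S k))|easy].
Qed.

Lemma gcong_inv k x y : gcong k x y -> gcong k x^-1 y^-1.
Proof.
  unfold gcong. intros Hx.
  replace (x^-1^-1 ** y^-1) with (conjg (x^-1 ** y)^-1 x^-1) by grp.
  now apply (gamma_conj _ (S k)), (gamma_inv _ (S k)).
Qed.

Lemma norm1_bounded l : exists M, Forall (fun p : bool * (nat -> Z) => IZR (norm1 d (snd p)) <= INR M) l.
Proof.
  destruct (list_bound (fun (p : bool * (nat -> Z)) M => (norm1 d (snd p) <= Z.of_nat M)%Z) l)
    as [M HM].
  { intros; lia. }
  { intros p _. exists (Z.to_nat (norm1 d (snd p))). pose proof (norm1_nonneg d (snd p)). lia. }
  exists M. apply Forall_forall. intros p Hp. rewrite INR_IZR_INZ. now apply IZR_le, HM.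
Qed.

Lemma gcong_nprod k l a : (forall i, (i < d)%nat -> vsum l i = a i) ->
  gcong k (normal G U k d a) (nprod k l).
Proof.
  intros Hl. destruct (norm1_bounded l) as [M HM].
  destruct (wexpo_nprod 1 k M l (Nat.le_refl 1) HM) as (a' & Ha' & HP).
  unfold gcong. eapply normal_cong, HP.
  - intros i Hi. now rewrite Ha', Hl.
  - assert (Hr : 0 <= / INR 1) by now apply Rinv_range.
    apply Rmult_le_pos; [|now apply pow_le].
    apply Rmult_le_pos; apply pos_INR.
Qed.

Lemma level_len_normal k n h : level_len G U k n h -> exists a,
  (norm1 d a <= Z.of_nat n)%Z /\ gcong k (normal G U k d a) h.
Proof.
  intros (w & H1 & H2 & H3). exists (expo k w). split.
  - pose proof (norm1_expo_le 1 k d w ltac:(lra)) as Hn.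
    rewrite (wt_level_eq _ k), !pow1 in Hn by easy.
    rewrite INR_IZR_INZ in Hn.
    assert (Hn' : IZR (norm1 d (expo k w)) <= IZR (Z.of_nat (length w))) by lra.
    apply le_IZR in Hn'. lia.
  - apply (gcong_trans _ _ (ev G U w)); [|easy].
    assert (Hr : 0 <= / INR 1) by now apply Rinv_range.
    apply (normal_cong k (expo k w) (expo k w) (wt (/ INR 1) w)).
    + easy.
    + now apply wt_nonneg.
    + exists w. repeat split; [now apply level_eq_ge|lra].
Qed.

(** [lattice_basis] is applied to the exponent vectors whose normal word is congruent to an element
    of H. The generators obtained are lifted by [epsilon] to elements of H itself, so that
    remainders of words in V stay in H. *)
Lemma level_basis i : exists (V : nat -> G) (e C : nat),
  (forall t, H (V t) /\ gamma G i (V t)) /\ (forall t, (e <= t)%nat -> V t = gone)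
  /\ forall n h, H h -> level_len G U i n h -> level_len G (fun _ => V) i (C * n) h.
Proof.
  set (N := normal G U i d).
  destruct (lattice_basis d (fun a => exists h, H h /\ gcong i (N a) h)) as (B & C & HB & HC).
  { intros a b Hab (h & H1 & H2). exists h. split; [easy|].
    unfold N in *. now rewrite <- (normal_ext i a b Hab). }
  { intros a b (h & H1 & H2) (h' & H3 & H4). exists (h ** h'). split; [now apply orbit_mul|].
    apply (gcong_trans _ _ (N a ** N b)); [apply normal_add|now apply gcong_mul]. }
  { intros a (h & H1 & H2). exists h^-1. split; [now apply orbit_inv|].
    apply (gcong_trans _ _ (N a)^-1); [apply normal_opp|now apply gcong_inv]. }
  set (f := fun b => epsilon (inhabits gone) (fun h => H h /\ gcong i (N b) h)).
  assert (Hf : forall b, In b B -> H (f b) /\ gcong i (N b) (f b)).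
  { intros b Hb. apply (epsilon_spec (inhabits gone) (fun h => H h /\ gcong i (N b) h)).
    rewrite Forall_forall in HB. now apply HB. }
  assert (HN : forall a, gamma G i (N a)).
  { intros a. apply ev_gamma; [easy|]. apply level_eq_ge, normal_word_level. }
  exists (fun t => nth t (map f B) gone), (length B), C. repeat split.
  - destruct (nth_in_or_default t (map f B) gone) as [Hin|Hd].
    + apply in_map_iff in Hin as (b & <- & Hb). now apply Hf.
    + rewrite Hd. apply orbit_one.
  - destruct (nth_in_or_default t (map f B) gone) as [Hin|Hd].
    + apply in_map_iff in Hin as (b & <- & Hb). destruct (Hf b Hb) as [_ Hc].
      rewrite <- (mulVKg _ (N b) (f b)). apply gamma_mul; [easy|now apply gamma_S].
    + rewrite Hd. apply gamma_one.
  - intros t Ht. apply nth_overflow. now rewrite length_map.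
  - intros n h Hh HT. destruct (level_len_normal i n h HT) as (a & Ha & Hah).
    destruct (HC a) as (l & L1 & L2 & L3); [now exists h|].
    set (V := fun _ : nat => fun t => nth t (map f B) gone).
    assert (Hw : exists w, level_eq i w /\ length w = length l /\ gcong i (nprod i l) (ev G V w)).
    { clear L2 L3. induction L1 as [|[s b] l Hb Hl (w & W1 & W2 & W3)].
      - exists nil. repeat split; [constructor|]. apply gcong_refl.
      - simpl in Hb. destruct (In_nth (map f B) (f b) gone (in_map f _ _ Hb)) as (t & _ & Ht).
        exists ((s, (i, t)) :: w). repeat split.
        + constructor; easy.
        + simpl. now rewrite W2.
        + rewrite ev_cons. simpl nprod. apply gcong_mul; [|easy].
          unfold nterm, lv, V. simpl. rewrite Ht. destruct (Hf b Hb) as [_ Hc].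
          destruct s; [now apply gcong_inv|easy]. }
    destruct Hw as (w & W1 & W2 & W3). exists w. repeat split; [easy|rewrite W2; nia|].
    apply (gcong_trans _ _ (nprod i l)); [now apply gcong_sym|].
    apply (gcong_trans _ _ (N a)); [apply gcong_sym; now apply gcong_nprod|easy].
Qed.

Lemma ev_level_ext (V V' : nat -> nat -> G) i w :
  (forall t, V i t = V' i t) -> level_eq i w -> ev G V w = ev G V' w.
Proof.
  intros HV. induction 1 as [|[b [j t]] w Hl Hw IH]; [easy|].
  rewrite !ev_cons, IH. unfold lev in Hl. simpl in Hl. subst j.
  unfold lv. simpl. now rewrite HV.
Qed.

(** The order of the quantifiers is the point: C combines the distortion of the levels, the bases of
    H at each level and the Lipschitz bounds of their letters, all fixed before m; only E depends on
    m. *)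
Lemma orbit_growth : exists C, forall m A, (1 <= A)%nat ->
  len0 G U A (Nat.iter m phi g) ->
  exists E, forall k, len0 G U (E * (C * A) ^ k) (Nat.iter k (Nat.iter m phi) g).
Proof.
  assert (Hch : exists f : nat -> (nat -> G) * (nat * nat), forall i,
    let V := fst (f i) in let e := fst (snd (f i)) in let C := snd (snd (f i)) in
    (forall t, H (V t) /\ gamma G i (V t)) /\ (forall t, (e <= t)%nat -> V t = gone)
    /\ forall n h, H h -> level_len G U i n h -> level_len G (fun _ => V) i (C * n) h).
  { assert (Hex : forall i, exists p : (nat -> G) * (nat * nat),
      let V := fst p in let e := fst (snd p) in let C := snd (snd p) in
      (forall t, H (V t) /\ gamma G i (V t)) /\ (forall t, (e <= t)%nat -> V t = gone)
      /\ forall n h, H h -> level_len G U i n h -> level_len G (fun _ => V) i (C * n) h).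
    { intros i. destruct (level_basis i) as (V & e & C & HV). now exists (V, (e, C)). }
    exists (fun i => proj1_sig (constructive_indefinite_description _ (Hex i))).
    intros i. apply (proj2_sig (constructive_indefinite_description _ (Hex i))). }
  destruct Hch as (f & Hf).
  set (V := fun i => fst (f i)).
  assert (Vtriv : forall i t, (c <= i)%nat -> V i t = gone).
  { intros i t Hi. apply gamma_c, (gamma_le _ _ i); [easy|]. now apply Hf. }
  destruct (uniform_bound c (fun i e => forall t, (e <= t)%nat -> V i t = gone)) as (e & He).
  { intros i n m Hnm Hn t Ht. apply Hn. lia. }
  { intros i. exists (fst (snd (f i))). apply Hf. }
  { intros i Hi t _. now apply Vtriv. }
  assert (VT : forall i n h, H h -> level_len G U i n h -> level_len G V i (snd (snd (f i)) * n) h).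
  { intros i n h Hh HT. destruct (Hf i) as (_ & _ & H3).
    destruct (H3 n h Hh HT) as (w & W1 & W2 & W3). exists w. repeat split; [easy|easy|].
    now rewrite (ev_level_ext V (fun _ => V i) i w). }
  (* Splitting off one level after the other never leaves H, since the letters of V are in H. *)
  assert (Vgen : forall i h, H h -> gamma G i h -> exists w, level_ge i w /\ ev G V w = h).
  { intros i h Hh Hi. destruct (Nat.le_ge_cases c i) as [Hc|Hc].
    { exists nil. split; [constructor|]. symmetry. now apply gamma_c, (gamma_le _ _ i). }
    remember (c - i)%nat as j eqn:Ej. revert i h Hh Hi Hc Ej.
    induction j as [|j IH]; intros i h Hh Hi Hc Ej.
    { exists nil. split; [constructor|]. symmetry. apply gamma_c. now replace c with i by lia. }
    destruct (gamma_level_len G U U_gamma U_comm U_gen i h Hi) as (n & Hn).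
    destruct (VT i n h Hh Hn) as (w & W1 & _ & W3).
    destruct (IH (S i) ((ev G V w)^-1 ** h)) as (v & V1 & V2); [|easy|lia|lia|].
    - apply orbit_mul; [|easy]. apply orbit_inv, orbit_ev. intros; apply Hf.
    - exists (w ++ v). split.
      + apply level_ge_app; [now apply level_eq_ge|]. revert V1. apply level_ge_le. lia.
      + rewrite ev_app, V2. grp. }
  destruct (uniform_bound2 c e (fun i t K => forall m n,
    len0 G U n (Nat.iter m phi g) -> len0 G U (K * n) (Nat.iter m phi (V i t)))) as (K & HK).
  { intros i t n m Hnm Hn p q Hpq. apply (len0_le _ _ (n * q)); [nia|]. now apply Hn. }
  { intros i t. apply orbit_len. now apply Hf. }
  { intros i t Hit m n _. replace (V i t) with (gone : G).
    - rewrite (hom_one _ _ (hom_iter _ phi m phi_hom)). apply len0_one.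
    - destruct Hit; symmetry; [now apply Vtriv|now apply He]. }
  (* The image under phi^m of a letter of level i lies in [gamma i] and has length at most KA, so it
     has length O((KA)^(i+1)) at that level, first in U and then in V. The 1 added to K keeps the
     scale positive. *)
  destruct (uniform_bound c (fun i C => forall m A, (1 <= A)%nat ->
    len0 G U A (Nat.iter m phi g) -> forall t,
    level_len G V i (C * A ^ S i) (Nat.iter m phi (V i t)))) as (C0 & HC0).
  { intros i n m Hnm Hn p A HA Hp t. apply (level_len_le _ _ _ (n * A ^ S i)); [nia|]. now apply Hn. }
  { intros i. destruct (len0_level_len i) as (C & HC).
    exists (snd (snd (f i)) * (C * (K + 1) ^ S i))%nat. intros m A HA Hm t.
    rewrite <- !Nat.mul_assoc, <- Nat.pow_mul_l. apply VT.
    - apply orbit_iter. now apply Hf.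
    - apply HC; [nia|..].
      + apply (len0_le _ _ (K * A)); [nia|]. now apply HK.
      + apply hom_gamma; [now apply hom_iter|]. now apply Hf. }
  { intros i Hi m A HA Hm t. rewrite Vtriv by easy.
    rewrite (hom_one _ _ (hom_iter _ phi m phi_hom)). apply level_len_one. }
  exists (C0 + 1)%nat. intros m A HA Hm.
  destruct (Vgen 0%nat g) as (w & _ & W2).
  { exists ((false, (0, 0))%nat :: nil). simpl. apply gmulx1. }
  { exact I. }
  destruct (substitution_growth V e C0 (Nat.iter m phi) A) with (w := w) as (E & HE).
  - intros i t. now apply Hf.
  - intros i t [Hi|Ht]; [now apply Vtriv|now apply He].
  - now apply hom_iter.
  - easy.
  - intros i t. destruct (HC0 i m A HA Hm t) as (w1 & H1 & H2 & H3).
    destruct (fun Hh => Vgen (S i) _ Hh H3) as (w2 & H4 & H5).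
    { apply orbit_mul.
      - apply orbit_inv, orbit_ev. intros; apply Hf.
      - apply orbit_iter. now apply Hf. }
    exists w1, w2. repeat split; [easy|easy|easy|]. rewrite H5. grp.
  - exists E. intros k. rewrite <- W2. apply HE.
Qed.

End Orbit.

End Nilpotent.

(** * The alphabet of iterated commutators of a generating set *)

Section WordLength.
Variable G : group.
Variable gens : list G.

Definition len_le (n : nat) (x : G) : Prop :=
  exists w, word_over G gens w /\ (length w <= n)%nat /\ eval_word G w = x.

(** The left-normed commutators of k+1 generators. *)
Fixpoint lcs_gens (k : nat) : list G :=
  match k with
  | O => gens
  | S k => flat_map (fun u => map (fun s => [~ u, s]) gens) (lcs_gens k)
  end.

(** The default value makes every index a letter, trivial beyond the end of the list, as the bounds
    over all letters require. *)
Definition lcs_letter (k t : nat) : G := nth t (lcs_gens k) gone.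

Lemma lcs_letter_in k t : In (lcs_letter k t) (lcs_gens k) \/ lcs_letter k t = gone.
Proof. unfold lcs_letter. destruct (nth_in_or_default t (lcs_gens k) gone); auto. Qed.

Lemma lcs_letter_ex k x : In x (lcs_gens k) -> exists t, lcs_letter k t = x.
Proof. intros H. destruct (In_nth _ _ gone H) as (t & _ & Ht). now exists t. Qed.

Lemma lcs_gens_gamma k x : In x (lcs_gens k) -> gamma G k x.
Proof.
  revert x. induction k as [|k IH]; [easy|]. intros x Hx. simpl in Hx.
  apply in_flat_map in Hx as (u & Hu & Hx). apply in_map_iff in Hx as (s & <- & _).
  now apply gamma_comm, IH.
Qed.

Lemma lcs_letter_gamma k t : gamma G k (lcs_letter k t).
Proof.
  destruct (lcs_letter_in k t) as [H|H]; [now apply lcs_gens_gamma|].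
  rewrite H. apply gamma_one.
Qed.

Lemma lcs_letter_gone k : exists t, lcs_letter k t = gone.
Proof. exists (length (lcs_gens k)). now apply nth_overflow. Qed.

Lemma lcs_letter_comm k t s : exists b, [~ lcs_letter k t, lcs_letter 0 s] = lcs_letter (S k) b.
Proof.
  destruct (lcs_letter_gone (S k)) as [b Hb].
  destruct (lcs_letter_in k t) as [Ht|Ht]; [|exists b; rewrite Ht, Hb; grp].
  destruct (lcs_letter_in 0 s) as [Hs|Hs]; [|exists b; rewrite Hs, Hb; grp].
  destruct (lcs_letter_ex (S k) [~ lcs_letter k t, lcs_letter 0 s]) as [b' Hb'].
  - simpl. apply in_flat_map. exists (lcs_letter k t). split; [easy|].
    now apply (in_map (fun s => [~ lcs_letter k t, s])).
  - now exists b'.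
Qed.

Lemma lcs_letter_dec k t : lcs_letter (S k) t = gone
  \/ exists b s, lcs_letter (S k) t = [~ lcs_letter k b, lcs_letter 0 s].
Proof.
  destruct (lcs_letter_in (S k) t) as [H|H]; [right|now left].
  simpl in H. apply in_flat_map in H as (u & Hu & H). apply in_map_iff in H as (s & <- & Hs).
  destruct (lcs_letter_ex k u Hu) as [b <-]. destruct (lcs_letter_ex 0 s Hs) as [s' <-].
  now exists b, s'.
Qed.

Lemma len_le_len0 n x : len_le n x <-> len0 G lcs_letter n x.
Proof.
  split.
  - intros (w & H1 & H2 & <-). apply (len0_le _ _ (length w)); [easy|]. clear H2.
    induction H1 as [|[b s] w Hs Hw IH]; [apply len0_one|].
    simpl. apply (len0_mul _ _ 1); [|easy].
    destruct (lcs_letter_ex 0 s Hs) as [t Ht].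
    exists ((b, (0, t))%nat :: nil). repeat split.
    + now constructor.
    + easy.
    + simpl. unfold lv, letter_val. simpl. rewrite Ht. now rewrite gmulx1.
  - intros (w & H1 & H2 & <-).
    cut (exists v, word_over G gens v /\ (length v <= length w)%nat
      /\ eval_word G v = ev G lcs_letter w).
    { intros (v & V1 & V2 & V3). exists v. repeat split; [easy|lia|easy]. }
    clear H2. induction H1 as [|[b [i t]] w Hi Hw (v & V1 & V2 & V3)].
    + exists nil. repeat split; [constructor|easy].
    + unfold lev in Hi. simpl in Hi. subst i. rewrite ev_cons, <- V3.
      unfold lv. simpl. destruct (lcs_letter_in 0 t) as [H|H].
      * exists ((b, lcs_letter 0 t) :: v). repeat split; [now constructor|simpl; lia].
      * exists v. repeat split; [easy|lia|]. rewrite H.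
        destruct b; now rewrite ?invg1, gmul1x.
Qed.

Lemma level_len_lcs n x : level_len G lcs_letter 0 n x <-> exists w, word_over G gens w /\ (length w <= n)%nat
  /\ gamma G 1 ((eval_word G w)^-1 ** x).
Proof.
  split.
  - intros (w & H1 & H2 & H3).
    destruct (proj2 (len_le_len0 n (ev G lcs_letter w))) as (v & V1 & V2 & V3); [now exists w|].
    exists v. now rewrite V3.
  - intros (v & V1 & V2 & V3).
    destruct (proj1 (len_le_len0 n (eval_word G v))) as (w & W1 & W2 & W3); [now exists v|].
    exists w. now rewrite W3.
Qed.

Hypothesis S_gen : generates G gens.
Hypothesis G_nil : nilpotent G.

Lemma len_le_ex x : exists n, len_le n x.
Proof. destruct (S_gen x) as (w & H1 & H2). now exists (length w), w. Qed.

Lemma level_len_ex x : exists n, level_len G lcs_letter 0 n x.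
Proof.
  destruct (S_gen x) as (w & H1 & H2). exists (length w). apply level_len_lcs. exists w.
  repeat split; [easy|easy|]. rewrite H2, gmulVx. apply (gamma_one _ 1).
Qed.

Lemma lcs_letter_bounds : exists c d D,
  (forall x, gamma G c x -> x = gone)
  /\ (forall i t, (d <= t)%nat -> lcs_letter i t = gone)
  /\ (forall l m, exists w, level_ge (S (lev l + lev m)) w
       /\ (length w <= D)%nat /\ ev G lcs_letter w = [~ lv G lcs_letter l, lv G lcs_letter m]).
Proof.
  destruct G_nil as [c Hc].
  assert (Hci : forall i t, (c <= i)%nat -> lcs_letter i t = gone).
  { intros i t Hi. apply Hc, (gamma_le _ _ i); [easy|]. apply lcs_letter_gamma. }
  destruct (uniform_bound c (fun i d => forall t, (d <= t)%nat -> lcs_letter i t = gone))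
    as (d & Hd).
  { intros i n m Hnm Hn t Ht. apply Hn. lia. }
  { intros i. exists (length (lcs_gens i)). intros t Ht. now apply nth_overflow. }
  { intros i Hi t _. now apply Hci. }
  destruct (comm_letters_bound G lcs_letter lcs_letter_gamma lcs_letter_comm level_len_ex c Hc d)
    as (D & HD).
  { intros i t [Hi|Ht]; [now apply Hci|now apply Hd]. }
  exists c, d, D. now repeat split.
Qed.

Lemma len0_ex x : exists n, len0 G lcs_letter n x.
Proof. destruct (len_le_ex x) as [n Hn]. exists n. now apply len_le_len0. Qed.

Lemma len_le_lipschitz f : is_hom G f ->
  exists C, forall n x, len_le n x -> len_le (C * n) (f x).
Proof.
  intros Hf. destruct lcs_letter_bounds as (c & d & D & _ & Hd & _).
  destruct (len0_lipschitz G lcs_letter d Hd len0_ex f Hf) as (C & HC).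
  exists C. intros n x Hx. apply len_le_len0, HC. now apply len_le_len0.
Qed.

Lemma len_le_orbit phi g : is_hom G phi ->
  exists C, forall m A, (1 <= A)%nat -> len_le A (Nat.iter m phi g) ->
  exists E, forall k, len_le (E * (C * A) ^ k) (Nat.iter k (Nat.iter m phi) g).
Proof.
  intros Hphi. destruct lcs_letter_bounds as (c & d & D & Hc & Hd & HD).
  destruct (orbit_growth G lcs_letter c d D lcs_letter_gamma lcs_letter_comm lcs_letter_dec
    level_len_ex Hc Hd HD len0_ex phi Hphi g) as (C & HC).
  exists C. intros m A HA Hm. apply len_le_len0 in Hm.
  destruct (HC m A HA Hm) as (E & HE). exists E. intros k. now apply len_le_len0.
Qed.

Lemma len_le_abelian psi A : is_hom G psi -> (1 <= A)%nat ->
  (forall s, In s gens -> exists w, word_over G gens w /\ (length w <= A)%nat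
     /\ gamma G 1 ((eval_word G w)^-1 ** psi s)) ->
  forall x, exists E, forall k, len_le (E * (2 * A) ^ k) (Nat.iter k psi x).
Proof.
  intros Hpsi HA HT x. destruct lcs_letter_bounds as (c & d & D & Hc & Hd & HD).
  destruct (abelian_growth G lcs_letter c d D lcs_letter_gamma lcs_letter_comm lcs_letter_dec
    level_len_ex Hc Hd HD len0_ex psi A Hpsi HA) with (x := x) as (E & HE).
  - intros t. destruct (lcs_letter_in 0 t) as [H|H].
    + apply level_len_lcs. now apply HT.
    + rewrite H, hom_one by easy. apply level_len_one.
  - exists E. intros k. now apply len_le_len0.
Qed.

End WordLength.

(** * Growth rates *)

Lemma over_n_small (K eps : R) : 0 < eps -> exists N, forall n, (N <= n)%nat ->
  (1 <= n)%nat /\ K / INR n <= eps.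
Proof.
  intros He. destruct (nat_upper (K / eps)) as (N & HN1 & HN). exists N. intros n Hn.
  split; [lia|]. assert (Hn0 : 0 < INR n) by (apply lt_0_INR; lia).
  apply le_INR in Hn. apply (Rmult_le_reg_r (INR n)); [easy|].
  unfold Rdiv at 1. rewrite Rmult_assoc, Rinv_l by lra.
  assert (HK : K = K / eps * eps) by (field; lra). rewrite HK. nra.
Qed.

(** Writing n = qm + r with r < m, the bound at qm is carried to n by r Lipschitz steps; the
    constant part e + m c0 vanishes after division by n. *)
Lemma iter_growth_upper (x : nat -> R) (c0 e y : R) (m : nat) : 0 <= c0 -> 0 <= y ->
  (1 <= m)%nat -> (forall n, x (S n) <= x n + c0) ->
  (forall k, x (k * m)%nat <= e + INR k * y) ->
  forall eps, 0 < eps -> exists N, forall n, (N <= n)%nat -> x n / INR n <= y / INR m + eps.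
Proof.
  intros Hc0 Hy Hm Hlip Hk eps Heps.
  destruct (over_n_small (e + INR m * c0) eps Heps) as (N & HN).
  exists N. intros n Hn. destruct (HN n Hn) as [Hn1 Hne].
  assert (Hadd : forall r q, x (r + q)%nat <= x q + INR r * c0).
  { intros r q. induction r as [|r IH]; [simpl; lra|].
    rewrite S_INR. pose proof (Hlip (r + q)%nat) as H. simpl. lra. }
  set (q := (n / m)%nat). set (r := (n mod m)%nat).
  assert (En : n = (r + q * m)%nat).
  { unfold q, r. pose proof (Nat.div_mod n m ltac:(lia)). lia. }
  assert (Hr : (r < m)%nat) by (apply Nat.mod_upper_bound; lia).
  pose proof (Hadd r (q * m)%nat) as H1. rewrite <- En in H1. specialize (Hk q).
  assert (Hn0 : 0 < INR n) by (apply lt_0_INR; lia).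
  assert (Hm0 : 0 < INR m) by (apply lt_0_INR; lia).
  assert (Hq : INR q <= INR n / INR m).
  { apply (Rmult_le_reg_r (INR m)); [easy|]. unfold Rdiv. rewrite Rmult_assoc, Rinv_l by lra.
    rewrite Rmult_1_r, <- mult_INR. apply le_INR. lia. }
  assert (Hrm : INR r <= INR m) by (apply le_INR; lia).
  assert (H2 : x n <= (e + INR m * c0) + INR n / INR m * y) by nra.
  apply (Rle_trans _ (((e + INR m * c0) + INR n / INR m * y) / INR n)).
  - unfold Rdiv at 1 2. apply Rmult_le_compat_r; [|easy]. left. now apply Rinv_0_lt_compat.
  - replace (((e + INR m * c0) + INR n / INR m * y) / INR n)
      with ((e + INR m * c0) / INR n + y / INR m) by (field; lra). lra.
Qed.

(** The limit is the infimum of (c1 + x m) / m. The offset e may depend on m, because m is fixed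
    before n grows. The set E consists of opposites, as completeness provides suprema. *)
Lemma quasi_subadditive_limit (x : nat -> R) (c0 c1 : R) : 0 <= c0 -> 0 <= c1 ->
  (forall n, 0 <= x n) -> (forall n, x (S n) <= x n + c0) ->
  (forall m, exists e, forall k, x (k * m)%nat <= e + INR k * (c1 + x m)) ->
  exists l, 0 <= l /\ Un_cv (fun n => x n / INR n) l.
Proof.
  intros Hc0 Hc1 Hx Hlip Hsub.
  set (E := fun y => exists m, (1 <= m)%nat /\ y = - ((c1 + x m) / INR m)).
  assert (Hpos : forall m, (1 <= m)%nat -> 0 <= (c1 + x m) / INR m).
  { intros m Hm. apply Rmult_le_pos; [specialize (Hx m); lra|].
    left. apply Rinv_0_lt_compat, lt_0_INR. lia. }
  assert (Hub : is_upper_bound E 0).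
  { intros y (m & Hm & ->). specialize (Hpos m Hm). lra. }
  destruct (completeness E) as [b [Hb1 Hb2]].
  { now exists 0. }
  { exists (- ((c1 + x 1%nat) / INR 1)). now exists 1%nat. }
  exists (- b). split; [specialize (Hb2 0 Hub); lra|].
  assert (Hlow : forall m, (1 <= m)%nat -> - b <= (c1 + x m) / INR m).
  { intros m Hm. assert (H : - ((c1 + x m) / INR m) <= b) by (apply Hb1; now exists m). lra. }
  intros eps Heps.
  destruct (classic (exists m, (1 <= m)%nat /\ (c1 + x m) / INR m < - b + eps / 2))
    as [(m & Hm & Hmb)|Hno].
  2:{ exfalso. assert (H : is_upper_bound E (b - eps / 2)).
      { intros y (m & Hm & ->). apply Rnot_lt_le. intros Hlt. apply Hno. exists m.
        split; [easy|lra]. }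
      specialize (Hb2 _ H). lra. }
  destruct (Hsub m) as [e He].
  destruct (iter_growth_upper x c0 e (c1 + x m) m) with (eps := eps / 4) as (N1 & HN1);
    try easy; try (specialize (Hx m); lra).
  destruct (over_n_small c1 (eps / 2)) as (N2 & HN2); [lra|].
  exists (N1 + N2)%nat. intros n Hn. specialize (HN1 n ltac:(lia)).
  destruct (HN2 n ltac:(lia)) as [Hn1 Hcn]. specialize (Hlow n Hn1).
  assert (H : (c1 + x n) / INR n = c1 / INR n + x n / INR n).
  { unfold Rdiv. ring. }
  unfold Rdist. apply Rabs_def1; lra.
Qed.

Lemma nroot_cv (a : nat -> nat) l : (forall n, (1 <= a n)%nat) ->
  Un_cv (fun n => ln (INR (a n)) / INR n) l -> Un_cv (fun n => nroot n (INR (a n))) (exp l).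
Proof.
  intros Ha Hl.
  assert (Hc : Un_cv (fun n => exp (ln (INR (a n)) / INR n)) (exp l)).
  { apply (continuity_seq exp); [|easy]. apply derivable_continuous_pt, derivable_pt_exp. }
  intros eps Heps. destruct (Hc eps Heps) as [N HN]. exists N. intros n Hn.
  replace (nroot n (INR (a n))) with (exp (ln (INR (a n)) / INR n)); [now apply HN|].
  unfold nroot. destruct (Req_EM_T (INR (a n)) 0) as [H|H].
  - exfalso. specialize (Ha n). apply le_INR in Ha. simpl in Ha. lra.
  - unfold Rpower, Rdiv. f_equal. ring.
Qed.

Lemma ln_INR_nonneg n : (1 <= n)%nat -> 0 <= ln (INR n).
Proof.
  intros Hn. apply le_INR in Hn. simpl in Hn. rewrite <- ln_1.
  destruct Hn as [Hn|<-]; [left; apply ln_increasing; lra|lra].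
Qed.

Lemma ln_mono x y : 0 < x -> x <= y -> ln x <= ln y.
Proof. intros Hx [H|<-]; [left; now apply ln_increasing|lra]. Qed.

Lemma ln_INR_le n m : (1 <= n)%nat -> (n <= m)%nat -> ln (INR n) <= ln (INR m).
Proof. intros Hn Hm. apply ln_mono; [apply lt_0_INR; lia|now apply le_INR]. Qed.

Lemma ln_INR_mul n m : (1 <= n)%nat -> (1 <= m)%nat ->
  ln (INR (n * m)) = ln (INR n) + ln (INR m).
Proof. intros Hn Hm. rewrite mult_INR. apply ln_mult; apply lt_0_INR; lia. Qed.

Lemma ln_INR_pow n k : (1 <= n)%nat -> ln (INR (n ^ k)) = INR k * ln (INR n).
Proof. intros Hn. rewrite pow_INR. apply ln_pow, lt_0_INR. lia. Qed.

Lemma is_least_epsilon (Q : nat -> Prop) : (exists n, Q n) ->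
  is_least Q (epsilon (inhabits 0%nat) (is_least Q)).
Proof.
  intros H. apply epsilon_spec.
  destruct (dec_inh_nat_subset_has_unique_least_element Q) as [n [Hn _]]; [|easy|now exists n].
  intros n. apply classic.
Qed.

Lemma iter_iter {A : Type} (f : A -> A) k m x :
  Nat.iter k (Nat.iter m f) x = Nat.iter (k * m) f x.
Proof. induction k as [|k IH]; [easy|]. simpl. now rewrite IH, Nat.iter_add. Qed.

(** * Growth rates of injective endomorphisms of nilpotent groups *)

Section Growth.
Variable G : group.
Variable gens : list G.
Hypothesis S_gen : generates G gens.

Lemma wordlen_spec x : len_le G gens (wordlen G gens x) x.
Proof.
  destruct (is_least_epsilon (fun n => exists w, word_over G gens w /\ length w = n
    /\ eval_word G w = x)) as [(w & H1 & H2 & H3) _].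
  - destruct (S_gen x) as (w & H1 & H2). now exists (length w), w.
  - exists w. repeat split; [easy| |easy]. now apply Nat.eq_le_incl.
Qed.

Lemma wordlen_le n x : len_le G gens n x -> (wordlen G gens x <= n)%nat.
Proof.
  intros (w & H1 & H2 & H3).
  destruct (is_least_epsilon (fun n => exists w, word_over G gens w /\ length w = n
    /\ eval_word G w = x)) as [_ Hmin].
  - now exists (length w), w.
  - apply (Nat.le_trans _ (length w)); [|easy]. apply Hmin. now exists w.
Qed.

Lemma wordlen_pos x : x <> gone -> (1 <= wordlen G gens x)%nat.
Proof.
  intros Hx. destruct (wordlen_spec x) as (w & H1 & H2 & H3).
  destruct w as [|l w]; [now destruct Hx|]. simpl in H2. lia.
Qed.

Lemma wordlen_gone : wordlen G gens gone = 0%nat.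
Proof.
  apply Nat.le_0_r, wordlen_le. exists nil. repeat split; constructor.
Qed.

Hypothesis G_nil : nilpotent G.
Variable phi : G -> G.
Hypothesis phi_hom : is_hom G phi.

Lemma wordlen_lipschitz : exists c, 0 <= c /\ forall x, x <> gone -> phi x <> gone ->
  ln (INR (wordlen G gens (phi x))) <= ln (INR (wordlen G gens x)) + c.
Proof.
  destruct (len_le_lipschitz G gens S_gen G_nil phi phi_hom) as (C & HC).
  exists (ln (INR (C + 1))). split; [apply ln_INR_nonneg; lia|].
  intros x Hx Hpx. pose proof (wordlen_pos x Hx). pose proof (wordlen_pos _ Hpx).
  rewrite <- ln_INR_mul by lia. apply ln_INR_le; [easy|].
  apply (Nat.le_trans _ (C * wordlen G gens x)); [|nia].
  now apply wordlen_le, HC, wordlen_spec.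
Qed.

Hypothesis phi_inj : forall x, phi x = gone -> x = gone.

Lemma iter_nontrivial g n : g <> gone -> Nat.iter n phi g <> gone.
Proof. intros Hg. induction n as [|n IH]; [easy|]. simpl. intros H. now apply IH, phi_inj. Qed.

(** The logarithms of the lengths are quasi-subadditive with c1 = ln (C + 1), where C, from
    [len_le_orbit], does not depend on m. Adding 1 keeps the logarithm nonnegative if C = 0. *)
Lemma growth_limit g : g <> gone -> exists l, 0 <= l /\
  Un_cv (fun n => ln (INR (wordlen G gens (Nat.iter n phi g))) / INR n) l.
Proof.
  intros Hg. set (a := fun n => wordlen G gens (Nat.iter n phi g)).
  assert (Ha : forall n, (1 <= a n)%nat) by (intros n; now apply wordlen_pos, iter_nontrivial).
  destruct wordlen_lipschitz as (c0 & Hc0 & Hlip).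
  destruct (len_le_orbit G gens S_gen G_nil phi g phi_hom) as (C & HC).
  apply (quasi_subadditive_limit (fun n => ln (INR (a n))) c0 (ln (INR (C + 1)))).
  - easy.
  - apply ln_INR_nonneg. lia.
  - intros n. now apply ln_INR_nonneg.
  - intros n. apply Hlip; [now apply iter_nontrivial|apply (iter_nontrivial g (S n) Hg)].
  - intros m. destruct (HC m (a m) (Ha m) (wordlen_spec _)) as (E & HE).
    exists (ln (INR (E + 1))). intros k.
    rewrite <- ln_INR_mul, <- ln_INR_pow, <- ln_INR_mul; [|try lia..]; try (specialize (Ha m); nia).
    + apply ln_INR_le; [easy|].
      apply (Nat.le_trans _ (E * (C * a m) ^ k)).
      * apply wordlen_le. rewrite <- iter_iter. apply HE.
      * apply Nat.mul_le_mono; [lia|]. apply Nat.pow_le_mono_l. nia.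
    + apply Nat.neq_0_lt_0, Nat.pow_nonzero. specialize (Ha m). nia.
Qed.

(** One iterate phi^m, seen in the abelianization, bounds the rate of every element. The error ln 2,
    from the base 2A, is divided by m and disappears as m grows. *)
Lemma growth_le_abelian m A g l : g <> gone -> (1 <= m)%nat -> (1 <= A)%nat ->
  (forall s, In s gens -> exists w, word_over G gens w /\ (length w <= A)%nat
     /\ gamma G 1 ((eval_word G w)^-1 ** Nat.iter m phi s)) ->
  Un_cv (fun n => ln (INR (wordlen G gens (Nat.iter n phi g))) / INR n) l ->
  l <= (ln 2 + ln (INR A)) / INR m.
Proof.
  intros Hg Hm HA HT Hl.
  destruct wordlen_lipschitz as (c0 & Hc0 & Hlip).
  destruct (len_le_abelian G gens S_gen G_nil (Nat.iter m phi) A) with (x := g) as (E & HE);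
    try easy; [now apply hom_iter|].
  assert (HA0 := ln_INR_nonneg A HA).
  assert (E2 : ln (INR (2 * A)) = ln 2 + ln (INR A)).
  { rewrite ln_INR_mul by lia. now simpl (INR 2); replace (1 + 1) with 2 by ring. }
  assert (H2 : 0 <= ln 2).
  { rewrite <- ln_1. left. apply ln_increasing; lra. }
  apply Rnot_lt_le. intros Hlt.
  set (eps := (l - (ln 2 + ln (INR A)) / INR m) / 2).
  assert (Heps : 0 < eps) by (unfold eps; lra).
  destruct (iter_growth_upper (fun n => ln (INR (wordlen G gens (Nat.iter n phi g))))
    c0 (ln (INR (E + 1))) (ln 2 + ln (INR A)) m) with (eps := eps) as (N1 & HN1); try easy.
  - lra.
  - intros n. apply Hlip; [now apply iter_nontrivial|apply (iter_nontrivial g (S n) Hg)].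
  - intros k. rewrite <- E2, <- ln_INR_pow, <- ln_INR_mul by
      (try lia; apply Nat.neq_0_lt_0, Nat.pow_nonzero; lia).
    apply ln_INR_le; [now apply wordlen_pos, iter_nontrivial|].
    apply (Nat.le_trans _ (E * (2 * A) ^ k)); [|nia].
    apply wordlen_le. rewrite <- iter_iter. apply HE.
  - destruct (Hl eps Heps) as (N2 & HN2).
    specialize (HN1 (N1 + N2)%nat ltac:(lia)). specialize (HN2 (N1 + N2)%nat ltac:(lia)).
    unfold Rdist in HN2. apply Rabs_def2 in HN2. unfold eps in *. lra.
Qed.

End Growth.

(** * Quotients by terms of the lower central series *)

Section Quotient.
Variable G : group.
Variable k : nat.

Definition coset (x y : G) : Prop := gamma G k (x^-1 ** y).

(** Cosets are predicates, so that congruence becomes equality. The quotient serves to read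
    abelianized length as word length in a nilpotent group. *)
Definition quot : Type := {C : G -> Prop | exists x, C = coset x}.

Definition proj (x : G) : quot := exist _ (coset x) (ex_intro _ x eq_refl).

Lemma proj_eq x y : proj x = proj y <-> gamma G k (x^-1 ** y).
Proof.
  split.
  - intros H. apply (f_equal (@proj1_sig _ _)) in H. simpl in H.
    change (coset x y). rewrite H. unfold coset. rewrite gmulVx. apply gamma_one.
  - intros H. apply subset_eq_compat. apply functional_extensionality. intros z.
    apply propositional_extensionality. unfold coset. split; intros Hz.
    + replace (y^-1 ** z) with ((x^-1 ** y)^-1 ** (x^-1 ** z)) by grp.
      apply gamma_mul; [now apply gamma_inv|easy].
    + replace (x^-1 ** z) with (x^-1 ** y ** (y^-1 ** z)) by grp. now apply gamma_mul.
Qed.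

Lemma proj_surj (q : quot) : exists x, proj x = q.
Proof. destruct q as [C [x ->]]. now exists x. Qed.

Definition repr (q : quot) : G := proj1_sig (constructive_indefinite_description _ (proj_surj q)).

Lemma proj_repr q : proj (repr q) = q.
Proof. apply (proj2_sig (constructive_indefinite_description _ (proj_surj q))). Qed.

Lemma repr_proj x : gamma G k (x^-1 ** repr (proj x)).
Proof. apply proj_eq. symmetry. apply proj_repr. Qed.

Definition qmul (p q : quot) : quot := proj (repr p ** repr q).
Definition qinv (q : quot) : quot := proj (repr q)^-1.

Lemma qmul_proj x y : qmul (proj x) (proj y) = proj (x ** y).
Proof.
  symmetry. apply proj_eq.
  replace ((x ** y)^-1 ** (repr (proj x) ** repr (proj y)))
    with (conjg (x^-1 ** repr (proj x)) y ** (y^-1 ** repr (proj y))) by grp.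
  apply gamma_mul; [apply gamma_conj|]; apply repr_proj.
Qed.

Lemma qinv_proj x : qinv (proj x) = proj x^-1.
Proof.
  symmetry. apply proj_eq.
  replace (x^-1^-1 ** (repr (proj x))^-1)
    with (conjg (x^-1 ** repr (proj x))^-1 x^-1) by grp.
  apply gamma_conj, gamma_inv, repr_proj.
Qed.

Lemma qmulA p q r : qmul p (qmul q r) = qmul (qmul p q) r.
Proof.
  rewrite <- (proj_repr p), <- (proj_repr q), <- (proj_repr r).
  now rewrite !qmul_proj, gmulA.
Qed.

Lemma qmul1x q : qmul (proj gone) q = q.
Proof. rewrite <- (proj_repr q) at 1. now rewrite qmul_proj, gmul1x, proj_repr. Qed.

Lemma qmulx1 q : qmul q (proj gone) = q.
Proof. rewrite <- (proj_repr q) at 1. now rewrite qmul_proj, gmulx1, proj_repr. Qed.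

Lemma qmulVx q : qmul (qinv q) q = proj gone.
Proof. rewrite <- (proj_repr q). now rewrite qinv_proj, qmul_proj, gmulVx. Qed.

Lemma qmulxV q : qmul q (qinv q) = proj gone.
Proof. rewrite <- (proj_repr q). now rewrite qinv_proj, qmul_proj, gmulxV. Qed.

Definition quotient : group :=
  Group quot qmul qinv (proj gone) qmulA qmul1x qmulx1 qmulVx qmulxV.

Definition pi (x : G) : quotient := proj x.

Lemma pi_mul x y : pi (x ** y) = pi x ** pi y.
Proof. symmetry. apply qmul_proj. Qed.

Lemma pi_inv x : pi x^-1 = (pi x)^-1.
Proof. symmetry. apply qinv_proj. Qed.

Lemma pi_gone x : pi x = gone <-> gamma G k x.
Proof.
  pose proof (proj_eq gone x) as H. rewrite invg1, gmul1x in H.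
  split; intros Hx; [apply H|]; symmetry; [exact Hx|now apply H].
Qed.

Lemma pi_eq x y : pi x = pi y <-> gamma G k (x^-1 ** y).
Proof. apply proj_eq. Qed.

Lemma pi_surj (q : quotient) : exists x, pi x = q.
Proof. apply proj_surj. Qed.

Lemma gamma_quotient j q : gamma quotient j q -> exists x, gamma G j x /\ pi x = q.
Proof.
  revert q. induction j as [|j IH].
  { intros q _. destruct (pi_surj q) as [x Hx]. now exists x. }
  apply gamma_ind.
  - exists gone. split; [apply (gamma_one _ (S j))|easy].
  - intros p q _ (x & Hx & <-) _ (y & Hy & <-). exists (x ** y).
    split; [now apply (gamma_mul _ (S j))|apply pi_mul].
  - intros q _ (x & Hx & <-). exists x^-1. split; [now apply (gamma_inv _ (S j))|apply pi_inv].
  - intros q h Hq. destruct (IH q Hq) as (x & Hx & <-). destruct (pi_surj h) as (y & <-).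
    exists [~ x, y]. split; [now apply gamma_comm|].
    unfold comm. now rewrite !pi_mul, !pi_inv.
Qed.

Lemma quotient_nilpotent : nilpotent quotient.
Proof.
  exists k. intros q Hq. destruct (gamma_quotient k q Hq) as (x & Hx & <-). now apply pi_gone.
Qed.

Lemma eval_word_pi w :
  eval_word quotient (map (fun l => (fst l, pi (snd l))) w) = pi (eval_word G w).
Proof.
  induction w as [|[b s] w IH]; [easy|].
  change (letter_val quotient (b, pi s)
    ** eval_word quotient (map (fun l => (fst l, pi (snd l))) w)
    = pi (letter_val G (b, s) ** eval_word G w)).
  rewrite pi_mul, IH. destruct b; [|easy].
  unfold letter_val. simpl fst. cbv iota. simpl snd. now rewrite pi_inv.
Qed.

Lemma word_over_pi gens w : word_over quotient (map pi gens) w ->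
  exists v, word_over G gens v /\ w = map (fun l => (fst l, pi (snd l))) v.
Proof.
  induction 1 as [|[b q] w Hq Hw (v & V1 & V2)].
  - exists nil. split; [constructor|easy].
  - simpl in Hq. apply in_map_iff in Hq as (s & <- & Hs). exists ((b, s) :: v).
    split; [now constructor|]. simpl. now rewrite V2.
Qed.

Lemma word_over_map gens w : word_over G gens w ->
  word_over quotient (map pi gens) (map (fun l => (fst l, pi (snd l))) w).
Proof.
  intros H. apply Forall_map. revert H. apply Forall_impl. intros l Hl. now apply (in_map pi).
Qed.

Lemma quotient_generates gens : generates G gens -> generates quotient (map pi gens).
Proof.
  intros H q. destruct (pi_surj q) as (x & <-). destruct (H x) as (w & H1 & H2).
  exists (map (fun l => (fst l, pi (snd l))) w). split; [now apply word_over_map|].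
  now rewrite eval_word_pi, H2.
Qed.

Definition induced (phi : G -> G) (q : quotient) : quotient := pi (phi (repr q)).

Lemma induced_pi phi x : is_hom G phi -> induced phi (pi x) = pi (phi x).
Proof.
  intros Hphi. symmetry. apply pi_eq.
  rewrite <- (hom_inv G phi) by easy. rewrite <- Hphi. apply hom_gamma; [easy|].
  apply repr_proj.
Qed.

Lemma induced_hom phi : is_hom G phi -> is_hom quotient (induced phi).
Proof.
  intros Hphi p q. destruct (pi_surj p) as (x & <-), (pi_surj q) as (y & <-).
  rewrite <- pi_mul, !induced_pi by easy. now rewrite Hphi, pi_mul.
Qed.

Lemma induced_iter phi n x : is_hom G phi ->
  Nat.iter n (induced phi) (pi x) = pi (Nat.iter n phi x).
Proof.
  intros Hphi. induction n as [|n IH]; [easy|].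
  change (induced phi (Nat.iter n (induced phi) (pi x)) = pi (phi (Nat.iter n phi x))).
  now rewrite IH, induced_pi.
Qed.

End Quotient.

(** Words over the generators and words over their images correspond letter by letter, so the two
    minimized predicates are equal and [epsilon] chooses the same value. *)
Lemma ab_wordlen_quotient G gens x :
  ab_wordlen G gens x = wordlen (quotient G 1) (map (pi G 1) gens) (pi G 1 x).
Proof.
  unfold ab_wordlen, wordlen. f_equal. f_equal. apply functional_extensionality. intros n.
  apply propositional_extensionality. split.
  - intros (w & H1 & H2 & H3). exists (map (fun l => (fst l, pi G 1 (snd l))) w). repeat split.
    + now apply word_over_map.
    + now rewrite length_map.
    + rewrite eval_word_pi. symmetry. now apply pi_eq.
  - intros (w & H1 & H2 & H3). destruct (word_over_pi G 1 gens w H1) as (v & V1 & ->).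
    exists v. repeat split; [easy|now rewrite length_map in H2|].
    rewrite eval_word_pi in H3. now apply pi_eq.
Qed.

(** * Comparison of entropies *)

Lemma ab_wordlen_spec G gens x : generates G gens -> exists w, word_over G gens w
  /\ length w = ab_wordlen G gens x /\ gamma G 1 ((eval_word G w)^-1 ** x).
Proof.
  intros Hgen. destruct (is_least_epsilon (fun n => exists w, word_over G gens w /\ length w = n
    /\ in_commutator G (x^-1 ** eval_word G w))) as [(w & H1 & H2 & H3) _].
  - destruct (Hgen x) as (w & H1 & H2). exists (length w), w. repeat split; [easy|].
    rewrite H2, gmulVx. apply (gamma_one _ 1).
  - exists w. repeat split; [easy|easy|].
    replace ((eval_word G w)^-1 ** x) with (x^-1 ** eval_word G w)^-1 by grp.
    now apply (gamma_inv _ 1).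
Qed.

Lemma ab_wordlen_le G gens x : generates G gens ->
  (ab_wordlen G gens x <= wordlen G gens x)%nat.
Proof.
  intros Hgen. rewrite ab_wordlen_quotient.
  apply wordlen_le. destruct (wordlen_spec G gens Hgen x) as (w & H1 & H2 & H3).
  exists (map (fun l => (fst l, pi G 1 (snd l))) w). repeat split.
  - now apply word_over_map.
  - now rewrite length_map.
  - now rewrite eval_word_pi, H3.
Qed.

Lemma nroot_mono n a b : (a <= b)%nat -> nroot n (INR a) <= nroot n (INR b).
Proof.
  intros Hab. unfold nroot.
  destruct (Req_EM_T (INR a) 0) as [Ha|Ha], (Req_EM_T (INR b) 0) as [Hb|Hb].
  - lra.
  - left. apply exp_pos.
  - exfalso. apply Ha. apply (INR_eq b 0) in Hb. subst b. now apply Nat.le_0_r in Hab as ->.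
  - assert (Ha0 : 0 < INR a) by (pose proof (pos_INR a); lra).
    apply Rle_Rpower_l; [|split; [easy|now apply le_INR]].
    destruct n as [|n].
    + simpl. rewrite Rinv_0. lra.
    + left. apply Rinv_0_lt_compat, lt_0_INR. lia.
Qed.

(** For trivial g all lengths are 0, and the limit is 0 by the convention of [nroot] at 0; otherwise
    the rate is also given in the logarithmic form used by [growth_le_abelian]. *)
Lemma growth_nroot G gens phi : generates G gens -> nilpotent G -> is_hom G phi ->
  (forall x, phi x = gone -> x = gone) -> forall g, exists L,
  Un_cv (fun n => nroot n (INR (wordlen G gens (Nat.iter n phi g)))) L
  /\ (g = gone \/ 0 < L /\
     Un_cv (fun n => ln (INR (wordlen G gens (Nat.iter n phi g))) / INR n) (ln L)).
Proof.
  intros Hgen Hnil Hphi Hinj g. destruct (classic (g = gone)) as [->|Hg].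
  - exists 0. split; [|now left]. intros eps Heps. exists 0%nat. intros n _.
    rewrite (hom_one _ _ (hom_iter _ phi n Hphi)), wordlen_gone.
    unfold nroot. destruct (Req_EM_T (INR 0) 0) as [_|H]; [|now destruct H].
    unfold Rdist. now rewrite Rminus_diag, Rabs_R0.
  - destruct (growth_limit G gens Hgen Hnil phi Hphi Hinj g Hg) as (l & _ & Hl).
    exists (exp l). split.
    + apply nroot_cv; [|easy]. intros n.
      apply wordlen_pos; [easy|]. now apply iter_nontrivial.
    + right. rewrite ln_exp. split; [apply exp_pos|easy].
Qed.

Lemma fold_Rmax_ge_1 l : 1 <= fold_right Rmax 1 l.
Proof.
  induction l as [|x l IH]; simpl; [lra|]. apply (Rle_trans _ _ _ IH), Rmax_r.
Qed.

Lemma fold_Rmax_ge x l : In x l -> x <= fold_right Rmax 1 l.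
Proof.
  induction l as [|y l IH]; [easy|]. intros [->|Hx]; simpl; [apply Rmax_l|].
  apply (Rle_trans _ _ _ (IH Hx)), Rmax_r.
Qed.

Lemma fold_Rmax_le l b : 1 <= b -> (forall x, In x l -> x <= b) -> fold_right Rmax 1 l <= b.
Proof.
  intros Hb. induction l as [|y l IH]; intros H; [easy|]. simpl. apply Rmax_lub.
  - apply H. now left.
  - apply IH. intros x Hx. apply H. now right.
Qed.

(** The maximum with 1 takes care of abelianized lengths equal to 0. *)
Lemma nroot_upper (a : nat -> nat) L k : Un_cv (fun n => nroot n (INR (a n))) L -> 0 <= k ->
  L < exp k -> exists N, forall n, (N <= n)%nat -> ln (INR (Nat.max 1 (a n))) <= INR n * k.
Proof.
  intros Ha Hk HL. destruct (Ha (exp k - L)) as (N & HN); [lra|].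
  exists (N + 1)%nat. intros n Hn. specialize (HN n ltac:(lia)).
  assert (Hn0 : 0 < INR n) by (apply lt_0_INR; lia).
  destruct (Nat.eq_dec (a n) 0) as [E|E].
  { rewrite E. simpl. rewrite ln_1. nra. }
  replace (Nat.max 1 (a n)) with (a n) by lia.
  unfold Rdist, nroot in HN. destruct (Req_EM_T (INR (a n)) 0) as [H|H].
  { apply (INR_eq _ 0) in H. lia. }
  apply Rabs_def2 in HN as [HN _]. unfold Rpower in HN.
  assert (H1 : exp (/ INR n * ln (INR (a n))) < exp k) by lra.
  apply exp_lt_inv in H1. apply (Rmult_lt_compat_l (INR n)) in H1; [|easy].
  rewrite <- Rmult_assoc, Rinv_r, Rmult_1_l in H1; lra.
Qed.

Theorem theorem1p2 (N : group) (S : list N) (phi : N -> N) :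
  generates N S ->
  nilpotent N ->
  torsion_free N ->
  is_automorphism N phi ->
  exists K : R,
    entropy_is (wordlen N S) phi S K /\
    entropy_is (ab_wordlen N S) phi S K.
Proof.
  intros Hgen Hnil _ [Hphi (psi & Hpsi1 & Hpsi2)].
  change (is_hom N phi) in Hphi.
  assert (Hpsi : is_hom N psi).
  { intros x y. rewrite <- (Hpsi2 x), <- (Hpsi2 y) at 1. now rewrite <- Hphi, !Hpsi1. }
  assert (Hinj : forall x, phi x = gone -> x = gone).
  { intros x Hx. now rewrite <- (Hpsi1 x), Hx, hom_one. }
  (* The inverse of phi preserves [gamma 1] too, so phi is injective on the abelianization. *)
  assert (HinjQ : forall q, induced N 1 phi q = gone -> q = gone).
  { intros q Hq. destruct (pi_surj N 1 q) as (x & <-). rewrite induced_pi in Hq by easy.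
    apply pi_gone in Hq. apply pi_gone. rewrite <- (Hpsi1 x). now apply hom_gamma. }
  assert (HN := growth_nroot N S phi Hgen Hnil Hphi Hinj).
  (* The abelianized limits exist by the nilpotent case, applied to the quotient by [gamma 1]. *)
  assert (HQ : forall g, exists L, Un_cv (fun n => nroot n (INR (ab_wordlen N S (Nat.iter n phi g)))) L).
  { intros g.
    destruct (growth_nroot _ _ (induced N 1 phi) (quotient_generates N 1 S Hgen)
      (quotient_nilpotent N 1) (induced_hom N 1 phi Hphi) HinjQ (pi N 1 g)) as (L & HL & _).
    exists L. intros eps Heps. destruct (HL eps Heps) as (M & HM). exists M. intros n Hn.
    rewrite ab_wordlen_quotient, <- induced_iter by easy. now apply HM. }
  set (LN := fun g => proj1_sig (constructive_indefinite_description _ (HN g))).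
  assert (HLN := fun g => proj2_sig (constructive_indefinite_description _ (HN g))).
  set (LQ := fun g => proj1_sig (constructive_indefinite_description _ (HQ g))).
  assert (HLQ := fun g => proj2_sig (constructive_indefinite_description _ (HQ g))).
  change (forall g, Un_cv (fun n => nroot n (INR (wordlen N S (Nat.iter n phi g)))) (LN g)
    /\ (g = gone \/ 0 < LN g /\
       Un_cv (fun n => ln (INR (wordlen N S (Nat.iter n phi g))) / INR n) (ln (LN g)))) in HLN.
  change (forall g, Un_cv (fun n => nroot n (INR (ab_wordlen N S (Nat.iter n phi g)))) (LQ g))
    in HLQ.
  clearbody LN LQ. clear HN HQ.
  set (K := fold_right Rmax 1 (map LQ S)).
  assert (HK1 : 1 <= K) by apply fold_Rmax_ge_1.
  assert (HK0 : 0 <= ln K) by (rewrite <- ln_1; apply ln_mono; lra).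
  exists K. split; [exists LN|exists LQ; now split]. split; [intros s _; apply HLN|].
  apply Rle_antisym.
  (* Projection does not increase length, so here the limits compare generator by generator. In the
     other direction each limit is bounded by the maximum of all abelianized ones. *)
  { apply fold_Rmax_le; [apply fold_Rmax_ge_1|]. intros x Hx.
    apply in_map_iff in Hx as (s & <- & Hs).
    apply (Rle_trans _ (LN s)); [|now apply fold_Rmax_ge, in_map].
    refine (Rle_cv_lim _ (HLQ s) (proj1 (HLN s))).
    intros n. now apply nroot_mono, ab_wordlen_le. }
  apply fold_Rmax_le; [easy|]. intros x Hx. apply in_map_iff in Hx as (s & <- & Hs).
  destruct (classic (s = gone)) as [->|Hs1].
  { apply (Rle_trans _ 0); [|lra]. right. refine (UL_sequence _ _ _ (proj1 (HLN gone)) _).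
    intros eps Heps. exists 0%nat. intros n _.
    rewrite (hom_one _ _ (hom_iter _ phi n Hphi)), wordlen_gone.
    unfold nroot. destruct (Req_EM_T (INR 0) 0) as [_|H]; [|now destruct H].
    unfold Rdist. now rewrite Rminus_diag, Rabs_R0. }
  destruct (HLN s) as [_ [Hs2|[Hpos Hl]]]; [easy|].
  rewrite <- (exp_ln (LN s)), <- (exp_ln K) by lra. apply exp_mono_le, le_epsilon. intros eps Heps.
  (* Half of eps absorbs the convergence of the abelianized limits, simultaneously for all
     generators; the other half absorbs ln 2 / m. *)
  destruct (list_bound (fun s M => forall n, (M <= n)%nat ->
    ln (INR (Nat.max 1 (ab_wordlen N S (Nat.iter n phi s)))) <= INR n * (ln K + eps / 2)) S)
    as (M1 & HM1).
  { intros t n m Hnm Hn p Hp. apply Hn. lia. }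
  { intros t Ht. apply (nroot_upper _ (LQ t)); [apply HLQ|lra|].
    apply (Rle_lt_trans _ K); [now apply fold_Rmax_ge, in_map|].
    rewrite <- (exp_ln K) at 1 by lra. apply exp_increasing. lra. }
  destruct (over_n_small (ln 2) (eps / 2)) as (M2 & HM2); [lra|].
  set (m := (M1 + M2)%nat). destruct (HM2 m ltac:(lia)) as [Hm Hm2].
  (* Starting from 1 keeps A positive even if all these abelianized lengths are 0. *)
  set (A := fold_right Nat.max 1%nat (map (fun t => ab_wordlen N S (Nat.iter m phi t)) S)).
  assert (HA : forall l, (1 <= fold_right Nat.max 1 l)%nat
    /\ forall y, In y l -> (y <= fold_right Nat.max 1 l)%nat).
  { induction l as [|y l [IH1 IH2]]; simpl; split; try easy; [lia|].
    intros z [<-|Hz]; [lia|]. specialize (IH2 z Hz). lia. }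
  assert (HlnA : ln (INR A) <= INR m * (ln K + eps / 2)).
  { cut (forall S', incl S' S -> ln (INR (fold_right Nat.max 1%nat
      (map (fun t => ab_wordlen N S (Nat.iter m phi t)) S'))) <= INR m * (ln K + eps / 2)).
    { intros H. apply H, incl_refl. }
    induction S' as [|t S' IH]; intros HS.
    - simpl. rewrite ln_1. apply Rmult_le_pos; [apply pos_INR|lra].
    - assert (Ht := HM1 t (HS t (or_introl eq_refl)) m ltac:(lia)). simpl map. simpl fold_right.
      set (l := map _ S') in *. pose proof (proj1 (HA l)) as HF.
      set (F := fold_right Nat.max 1%nat l) in *.
      destruct (Nat.max_spec (ab_wordlen N S (Nat.iter m phi t)) F) as [[_ ->]|[H ->]].
      + apply IH. intros u Hu. apply HS. now right.
      + replace (ab_wordlen N S (Nat.iter m phi t))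
          with (Nat.max 1 (ab_wordlen N S (Nat.iter m phi t))) by lia. easy. }
  assert (HlA := growth_le_abelian N S Hgen Hnil phi Hphi Hinj m A s (ln (LN s)) Hs1 Hm).
  refine (Rle_trans _ _ _ (HlA _ _ Hl) _).
  - apply (proj1 (HA _)).
  - intros t Ht. destruct (ab_wordlen_spec N S (Nat.iter m phi t) Hgen) as (w & H1 & H2 & H3).
    exists w. repeat split; [easy| |easy]. rewrite H2. apply (proj2 (HA _)).
    now apply (in_map (fun t => ab_wordlen N S (Nat.iter m phi t))).
  - assert (Hm0 : 0 < INR m) by (apply lt_0_INR; lia).
    apply (Rle_trans _ (ln 2 / INR m + (ln K + eps / 2))); [|lra].
    replace ((ln 2 + ln (INR A)) / INR m) with (ln 2 / INR m + ln (INR A) / INR m)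
      by (field; lra).
    apply Rplus_le_compat_l. apply (Rmult_le_reg_r (INR m)); [easy|].
    unfold Rdiv. rewrite Rmult_assoc, Rinv_l by lra. lra.
Qed.
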